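(* Let $\kappa$ be a singular (uncountable) cardinal with $2^{<\kappa}=\kappa$, and let $X$ be a nonempty regular Hausdorff space of weight at most $\kappa$ such that every open subset of $X$ is a union of at most $\operatorname{cof}(\kappa)$-many closed sets (i.e. $\kappa\text{-}\boldsymbol{\Sigma}^0_1(X)\subseteq\operatorname{cof}(\kappa)^+\text{-}\boldsymbol{\Sigma}^0_2(X)$). Let $\alpha<\kappa^+$. (1) If $\alpha$ is even, then there are ${}^{\kappa}2$-universal sets for both $\kappa\text{-}\boldsymbol{\Sigma}^0_{1+\alpha}(X)$ and $\kappa\text{-}\boldsymbol{\Pi}^0_{1+\alpha}(X)$. Therefore there exist subsets of ${}^{\kappa}2$ that are $\kappa$-complete for $\kappa\text{-}\boldsymbol{\Sigma}^0_{1+\alpha}$ and $\kappa\text{-}\boldsymbol{\Pi}^0_{1+\alpha}$, respectively. In contrast, there is no ${}^{\kappa}2$-universal set for $\kappa\text{-}\boldsymbol{\Delta}^0_{1+\alpha}({}^{\kappa}2)$ or $\kappa\text{-}\mathbf{Bor}({}^{\kappa}2)$. (2) If $\alpha$ is odd, then there are neither ${}^{\kappa}2$-universal sets for $\kappa\text{-}\boldsymbol{\Sigma}^0_{1+\alpha}({}^{\kappa}2)$ nor subsets of ${}^{\kappa}2$ that are $\kappa$-complete for $\kappa\text{-}\boldsymbol{\Sigma}^0_{1+\alpha}$, and the same holds for $\kappa\text{-}\boldsymbol{\Pi}^0_{1+\alpha}$ and $\kappa\text{-}\boldsymbol{\Delta}^0_{1+\alpha}$. Moreover, suppose that ${}^{\kappa}2$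 embeds (topologically) into $X$. If $\alpha$ is even, there are $X$-universal sets for $\kappa\text{-}\boldsymbol{\Sigma}^0_{1+\alpha}(X)$ and $\kappa\text{-}\boldsymbol{\Pi}^0_{1+\alpha}(X)$, there are subsets of $X$ that are $\kappa$-complete for $\kappa\text{-}\boldsymbol{\Sigma}^0_{1+\alpha}$ and $\kappa\text{-}\boldsymbol{\Pi}^0_{1+\alpha}$, respectively, and there is no $X$-universal set for $\kappa\text{-}\boldsymbol{\Delta}^0_{1+\alpha}(X)$ or $\kappa\text{-}\mathbf{Bor}(X)$; if $\alpha$ is odd, there are neither $X$-universal sets for $\kappa\text{-}\boldsymbol{\Sigma}^0_{1+\alpha}(X)$ nor subsets of $X$ that are $\kappa$-complete for $\kappa\text{-}\boldsymbol{\Sigma}^0_{1+\alpha}$, and the same holds for $\kappa\text{-}\boldsymbol{\Pi}^0_{1+\alpha}$ and $\kappa\text{-}\boldsymbol{\Delta}^0_{1+\alpha}$.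
   Context: For a topological space $X$ and an ordinal $\gamma>\omega$, define by recursion on ordinals $\alpha\ge 1$: $\gamma\text{-}\boldsymbol{\Sigma}^0_1(X)$ is the family of open sets; for $\alpha>1$, $\gamma\text{-}\boldsymbol{\Sigma}^0_\alpha(X)$ is the family of all unions $\bigcup_{\xi<\delta}A_\xi$ with $\delta<\gamma$ and each $A_\xi\in\bigcup_{1\le\beta<\alpha}\gamma\text{-}\boldsymbol{\Pi}^0_\beta(X)$; $\gamma\text{-}\boldsymbol{\Pi}^0_\alpha(X)$ is the family of complements of sets in $\gamma\text{-}\boldsymbol{\Sigma}^0_\alpha(X)$; $\gamma\text{-}\boldsymbol{\Delta}^0_\alpha(X)=\gamma\text{-}\boldsymbol{\Sigma}^0_\alpha(X)\cap\gamma\text{-}\boldsymbol{\Pi}^0_\alpha(X)$. $\gamma\text{-}\mathbf{Bor}(X)$ is the smallest family of subsets of $X$ containing the open sets and closed under complements and well-ordered unions of length less than $\gamma$. Each of these, with $X$ varying over all nonempty topological spaces, is a pointclass $\boldsymbol{\Gamma}$ (assigning to $X$ the family $\boldsymbol{\Gamma}(X)$). Every ordinal $\alpha$ is written uniquely as $\alpha=\lambda+n$ with $n<\omega$ and $\lambda=0$ or $\lambda$ limit; $\alpha$ is even (odd) if $n$ is even (odd). The space ${}^{\kappa}2$ carries the bounded topology, generated by the sets $[s]=\{x\in{}^{\kappa}2\mid s\subseteq x\}$ for $s\in{}^{<\kappa}2$. A set $\mathcal{U}\subseteq Y\times X$ is $Y$-universal for $\boldsymbol{\Gamma}(X)$ if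 $\mathcal{U}\in\boldsymbol{\Gamma}(Y\times X)$ and $\boldsymbol{\Gamma}(X)=\{\mathcal{U}_y\mid y\in Y\}$, where $\mathcal{U}_y=\{x\in X\mid(y,x)\in\mathcal{U}\}$. A set $A\subseteq X$ is $\kappa$-complete for $\boldsymbol{\Gamma}$ if $A\in\boldsymbol{\Gamma}(X)$ and for all $B\in\boldsymbol{\Gamma}({}^{\kappa}2)$ there is a continuous $f\colon{}^{\kappa}2\to X$ with $B=f^{-1}(A)$. *)

(* Defs.v *)
From HB Require Import structures.
From mathcomp Require Import all_boot.
From mathcomp Require Import boolp wochoice classical_sets functions cardinality.
From mathcomp Require Import filter topology.

Set Implicit Arguments.
Unset Strict Implicit.
Unset Printing Implicit Defensive.

Local Open Scope classical_set_scope.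
Local Open Scope card_scope.

Declare Scope ord_scope.
Delimit Scope ord_scope with ord.

(* An ordinal is given by a well-ordered type of that order type, and equality of
ordinals is isomorphism, [a =~ b].  The ordinals [xi < a] correspond to the
elements of [a], so that a family indexed by [xi < a] is a function on [a]. *)

Record ord := Ord {
  ord_car :> choiceType;
  ole : rel ord_car;
  ole_wo : well_order ole }.

Definition olt (a : ord) (x y : a) : bool := ole x y && (x != y).

Definition ord_iso (a b : ord) : Prop :=
  exists2 f : a -> b, bijective f & {mono f : x y / ole x y}.

Definition ord_lt (a b : ord) : Prop :=
  exists x : b, exists2 f : a -> b,
    {mono f : u v / ole u v} & range f = [set y | olt y x].

Definition ord_le (a b : ord) : Prop := ord_lt a b \/ ord_iso a b.

Notation "a =~ b" := (ord_iso a b) (at level 70) : ord_scope.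
Notation "a < b" := (ord_lt a b) : ord_scope.
Notation "a <= b" := (ord_le a b) : ord_scope.

Lemma ofin_wo n : well_order (fun i j : 'I_n => (i <= j)%N).
Proof.
apply: antisymmetric_well_order => [i j /anti_leq/val_inj//|A [x Ax]].
by case: (arg_minnP (@nat_of_ord n) Ax) => i Ai le_i; exists i; split.
Qed.

Definition ofin (n : nat) : ord := Ord (@ofin_wo n).

Definition ole_sum (a b : ord) (u v : a + b) : bool :=
  match u, v with
  | inl x, inl y => ole x y
  | inl _, inr _ => true
  | inr _, inl _ => false
  | inr x, inr y => ole x y
  end.

Lemma ole_sum_wo (a b : ord) : well_order (@ole_sum a b).
Proof.
have mem_wo (c : ord) : wo_chain (@ole c) predT by move=> A _; exact: ole_wo.
apply: antisymmetric_well_order => [|A [u Au]].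
  move=> [x|x] [y|y] //= xy; congr (_ _);
    exact: (wo_chain_antisymmetric (mem_wo _)).
have [[x Ax]|noA] := pselect (exists x, inl x \in A).
  have [|z [[Az zmin] _]] := @ole_wo a [pred x | inl x \in A]; first by exists x.
  by exists (inl z); split=> // -[y|y] Ay //=; exact: zmin.
have [|z [[Az zmin] _]] := @ole_wo b [pred x | inr x \in A].
  by case: u Au => x Ax; [case: noA; exists x | exists x].
exists (inr z); split=> // -[y|y] Ay /=; last exact: zmin.
by case: noA; exists y.
Qed.

Definition oadd (a b : ord) : ord := Ord (@ole_sum_wo a b).

Notation "a + b" := (oadd a b) : ord_scope.

Definition is_limit (a : ord) : Prop :=
  [set: a] !=set0 /\ forall x : a, exists y : a, olt x y.

Definition even_ord (a : ord) : Prop :=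
  exists (l : ord) (n : nat),
    [/\ (l =~ ofin 0)%ord \/ is_limit l, (a =~ l + ofin n)%ord & ~~ odd n].

Definition odd_ord (a : ord) : Prop :=
  exists (l : ord) (n : nat),
    [/\ (l =~ ofin 0)%ord \/ is_limit l, (a =~ l + ofin n)%ord & odd n].

Definition is_cardinal (k : ord) : Prop :=
  forall d : ord, (d < k)%ord -> [set: d] #!= [set: k].

Definition is_succ_cardinal (k kp : ord) : Prop :=
  [/\ is_cardinal kp, (k < kp)%ord &
      forall d : ord, is_cardinal d -> (k < d)%ord -> (kp <= d)%ord].

Definition cofinal_map (k d : ord) (f : d -> k) : Prop :=
  forall x : k, exists i : d, ole x (f i).

Definition is_cofinality (k mu : ord) : Prop :=
  (exists f : mu -> k, cofinal_map f) /\
  (forall d : ord, (d < mu)%ord -> ~ exists f : d -> k, cofinal_map f).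

(* Binary sequences of length [< k]: a length [b < k] is an element [x] of [k],
   and the indices [xi < b] are the elements of [k] below [x]. *)
Definition bseq_lt (k : ord) : Type := {x : k & {y : k | olt y x} -> bool}.

Definition cantor (k : ord) : Type := k -> bool.

HB.instance Definition _ (k : ord) := Choice.copy (cantor k) (k -> bool).

Definition cylinder (k : ord) (s : bseq_lt k) : set (cantor k) :=
  [set z | forall y : {y : k | olt y (tag s)}, z (val y) = tagged s y].

HB.instance Definition _ (k : ord) :=
  isSubBaseTopological.Build (cantor k) (range (@cylinder k)) id.

Definition weight_le (X : topologicalType) (k : ord) : Prop :=
  exists2 B : set (set X), basis B & B #<= [set: k].

Definition embeds (Y X : topologicalType) : Prop :=
  exists f : Y -> X, [/\ injective f, continuous f &
    forall U, open U -> exists2 V, open V & f @` U = V `&` range f].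

Definition pointclass := forall X : topologicalType, set (set X).

(* As ordinals are represented up to isomorphism, the recursion on [a >= 1] is
   an inductive definition (no set is in the class for [a = 0]).  The members
   [~` B i] of the union are in [bPi g (b i)]. *)
Inductive Sigma0 (g : ord) (X : topologicalType) : ord -> set X -> Prop :=
| Sigma0_open (a : ord) (A : set X) :
    (a =~ ofin 1)%ord -> open A -> Sigma0 g a A
| Sigma0_bigcup (a d : ord) (b : d -> ord) (B : d -> set X) :
    (ofin 1 < a)%ord -> (d < g)%ord ->
    (forall i, (ofin 1 <= b i)%ord /\ (b i < a)%ord) ->
    (forall i, Sigma0 g (b i) (B i)) ->
    Sigma0 g a (\bigcup_i ~` B i).

Definition bSigma (g a : ord) : pointclass := fun X => [set A | Sigma0 g a A].

Arguments bSigma : clear implicits.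

Definition bPi (g a : ord) : pointclass :=
  fun X => [set ~` A | A in bSigma g a X].

Arguments bPi : clear implicits.

Definition bDelta (g a : ord) : pointclass :=
  fun X => bSigma g a X `&` bPi g a X.

Definition bBor (g : ord) : pointclass := fun X =>
  smallest [set F : set (set X) |
    (forall A, F A -> F (~` A)) /\
    (forall (d : ord) (B : d -> set X),
       (d < g)%ord -> (forall i, F (B i)) -> F (\bigcup_i B i))] open.

Arguments bDelta : clear implicits.
Arguments bBor : clear implicits.

Definition universal (G : pointclass) (Y X : topologicalType)
    (U : set (Y * X)) : Prop :=
  G (Y * X)%type U /\ G X = range (xsection U).

Definition has_universal (G : pointclass) (Y X : topologicalType) : Prop :=
  exists U : set (Y * X), universal G U.

Definition complete (k : ord) (G : pointclass) (X : topologicalType)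
    (A : set X) : Prop :=
  G X A /\ forall B : set (cantor k), G (cantor k) B ->
    exists2 f : cantor k -> X, continuous f & B = f @^-1` A.

Definition has_complete (k : ord) (G : pointclass) (X : topologicalType) :
    Prop :=
  exists A : set X, complete k G A.

(* Main.v *)
Require Import Defs.
From HB Require Import structures.
From mathcomp Require Import all_boot finmap.
From mathcomp Require Import boolp wochoice classical_sets functions cardinality.
From mathcomp Require Import filter topology.

Set Implicit Arguments.
Unset Strict Implicit.
Unset Printing Implicit Defensive.

Local Open Scope classical_set_scope.
Local Open Scope card_scope.

(** The class of level [a] is [Sigma0 kappa a]; the level in question is
    [a = 1 + alpha]. By Koenig's theorem and [2 ^ (< kappa) = kappa], the sets of size
    less than [kappa], called small, are closed under products and exponentials
    ([small_exp]). Two consequences of singularity drive the proof.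

    First, assume that each set of level [a] is a union of [N] many complements of
    sets of level [a], with [N] small and fixed, and that level [a] is closed under
    unions of [kappa] many sets. At level [a + 1], an intersection of few unions over
    [N] is again a union of few intersections, so level [a + 1] is closed under
    complements ([odd_level_compl]). Second, [kappa] is a union of [mu] many proper
    segments, so a union of [kappa] many sets is a small union of small unions. Hence
    level [a + 2] consists of the unions of [kappa] many complements of sets of level
    [a], and inherits both assumptions ([Sigma0_succ2P], [open_like_succ2]). They also
    hold at limits of size at most [kappa], where a small family of levels is cofinal
    ([open_like_limit]), and at the start by the hypothesis on open sets. So they hold
    at all even levels, while the odd levels are closed under complements.

    These facts are needed in [X], in the Cantor space [C] and in their product with
    [C]; the decomposition of open sets into closed sets passes to products with [C]
    because [C] has [mu] many clopen partitions whose cells form a base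
    ([small_Fsigma_prod]).

    At even levels universal sets are built by induction, as for Polish spaces with
    [kappa] in place of the countable cardinal ([universal_even]); the sequences coded
    by a point are its coordinates under Goedel's pairing function ([coding]). They
    yield complete sets, and they extend from [C] to [X] along an embedding because
    every set of a level on a subspace is the trace of one on the space
    ([Sigma0_extend]). A class closed under complements and continuous preimages has
    no universal set, by diagonalization; this excludes them for [Delta], for the
    Borel sets and at odd levels. A complete set at an odd level would give a universal
    one ([odd_no_complete]). *)

(** * Well-ordered types *)

Section WellOrder.
Variable a : ord.
Implicit Types x y z : a.

Lemma ord_min (A : set a) : A !=set0 -> exists2 m, A m & forall x, A x -> ole m x.
Proof.
move=> [x Ax]; have [|m [[/asboolP Am mmin] _]] := @ole_wo a (mem A).
  by exists x; apply/asboolP.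
by exists m => // y Ay; apply: mmin; apply/asboolP.
Qed.

Lemma ole_wo_chain : wo_chain (@ole a) predT.
Proof. by move=> A _; exact: ole_wo. Qed.

Lemma ole_refl x : ole x x.
Proof. exact: (wo_chain_reflexive ole_wo_chain). Qed.

Lemma ole_anti x y : ole x y -> ole y x -> x = y.
Proof. by move=> xy yx; apply: (wo_chain_antisymmetric ole_wo_chain); rewrite // xy yx. Qed.

Lemma ole_total x y : ole x y || ole y x.
Proof. exact: (wo_chainW ole_wo_chain). Qed.

Lemma ole_trans x y z : ole x y -> ole y z -> ole x z.
Proof.
move=> xy yz; have [|m] := @ord_min [set t | [\/ t = x, t = y | t = z]].
  by exists x; constructor 1.
case=> -> mmin.
- exact: mmin (Or33 _ _ _).
- by rewrite (ole_anti xy (mmin x _)) //; constructor 1.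
- have zy : ole z y by apply: mmin; constructor 2.
  by rewrite -(ole_anti yz zy).
Qed.

Lemma oltNge x y : olt x y = ~~ ole y x.
Proof.
rewrite /olt; have := ole_total x y; case xy: (ole x y); case yx: (ole y x) => //= _.
  by rewrite (ole_anti xy yx) eqxx.
by apply/negP => /eqP E; rewrite E ole_refl in yx.
Qed.

Lemma oleNgt x y : ole x y = ~~ olt y x.
Proof. by rewrite oltNge negbK. Qed.

Lemma olt_irr x : olt x x = false.
Proof. by rewrite oltNge ole_refl. Qed.

Lemma oltW x y : olt x y -> ole x y.
Proof. by case/andP. Qed.

Lemma ole_lt_trans y x z : ole x y -> olt y z -> olt x z.
Proof.
move=> xy; rewrite !oltNge; apply: contraNN => zx; exact: ole_trans zx xy.
Qed.

Lemma olt_le_trans y x z : olt x y -> ole y z -> olt x z.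
Proof.
move=> + yz; rewrite !oltNge; apply: contraNN => zx; exact: ole_trans yz zx.
Qed.

Lemma olt_trans y x z : olt x y -> olt y z -> olt x z.
Proof. by move=> /oltW; exact: ole_lt_trans. Qed.

Lemma ole_eqVlt x y : ole x y -> x = y \/ olt x y.
Proof. by rewrite /olt => ->; case: eqVneq => /=; [left | right]. Qed.

Lemma olt_ind (P : a -> Prop) :
  (forall x, (forall y, olt y x -> P y) -> P x) -> forall x, P x.
Proof.
move=> IH x; apply: contrapT => nPx.
have [|m nPm mmin] := @ord_min [set x | ~ P x]; first by exists x.
apply: nPm; apply: IH => y ym; apply: contrapT => /mmin.
by apply/negP; rewrite -oltNge.
Qed.

Definition omax x y := if ole x y then y else x.

Lemma omaxl x y : ole x (omax x y).
Proof. by rewrite /omax; case: ifP => // _; exact: ole_refl. Qed.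

Lemma omaxr x y : ole y (omax x y).
Proof.
rewrite /omax; case: ifPn => [_|]; first exact: ole_refl.
by rewrite -oltNge => /oltW.
Qed.

Lemma omax_lub x y z : ole x z -> ole y z -> ole (omax x y) z.
Proof. by rewrite /omax; case: ifP. Qed.

End WellOrder.

Lemma mono_olt (a b : ord) (f : a -> b) :
  {mono f : x y / ole x y} -> {mono f : x y / olt x y}.
Proof. by move=> fm x y; rewrite !oltNge fm. Qed.

Lemma mono_inj (a b : ord) (f : a -> b) :
  {mono f : x y / ole x y} -> injective f.
Proof. by move=> fm x y fxy; apply: ole_anti; rewrite -fm fxy ole_refl. Qed.

Lemma olt_mono (a b : ord) (f : a -> b) :
  {homo f : x y / olt x y} -> {mono f : x y / ole x y}.
Proof.
move=> fh x y; apply/idP/idP; last first.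
  by move=> /ole_eqVlt[->|/fh/oltW //]; exact: ole_refl.
by rewrite !oleNgt; apply: contraNN; exact: fh.
Qed.

(** * Comparison of ordinals *)

Lemma oseg_wo (a : ord) (x : a) :
  well_order (fun u v : {y : a | olt y x} => ole (val u) (val v)).
Proof.
apply: antisymmetric_well_order => [u v /andP[uv vu]|A [u Au]].
  by apply: val_inj; exact: ole_anti.
have [|m [v Av <-] vmin] := @ord_min _ [set val v | v in [set v | v \in A]].
  by exists (val u), u.
by exists v; split=> // w Aw; apply: vmin; exists w.
Qed.

Definition oseg (a : ord) (x : a) : ord := Ord (@oseg_wo a x).

Definition init_emb (a b : ord) (f : a -> b) :=
  {mono f : x y / ole x y} /\ forall x y, olt y (f x) -> range f y.

Lemma init_emb_id (a : ord) : @init_emb a a id.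
Proof. by split=> // x y _; exists y. Qed.

Lemma init_emb_comp (a b c : ord) (f : a -> b) (g : b -> c) :
  init_emb f -> init_emb g -> init_emb (g \o f).
Proof.
move=> [fm fi] [gm gi]; split=> [x y|x y /= ygf]; first by rewrite /= gm fm.
have [z _ zy] := gi _ _ ygf; subst y.
by move: ygf; rewrite (mono_olt gm) => /fi[w _ <-]; exists w.
Qed.

Lemma init_emb_ge (a : ord) (f : a -> a) :
  {mono f : x y / ole x y} -> forall x, ole x (f x).
Proof.
move=> fm; apply: olt_ind => x IH; rewrite oleNgt; apply/negP => fxx.
by have := IH _ fxx; rewrite fm oleNgt fxx.
Qed.

Lemma ord_leP a b : (a <= b)%ord <-> exists f : a -> b, init_emb f.
Proof.
split=> [[[x [f fm fr]]|[f fb fm]]|[f [fm fi]]].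
- exists f; split=> // u y yfu; rewrite fr /=; apply: olt_trans yfu _.
  suff : [set y | olt y x] (f u) by [].
  by rewrite -fr; exists u.
- exists f; split=> // u y _; case: fb => g _ gK.
  by exists (g y).
- have [fs|] := pselect (forall y, range f y).
    right; exists f => //; rewrite -setTT_bijective; split=> //.
    exact: in2W (mono_inj fm).
  move/existsNP => [y0 ny0]; left.
  have [|m nm mmin] := @ord_min b [set y | ~ range f y]; first by exists y0.
  exists m, f => //; apply/seteqP; split=> [_ [u _ <-]|y /= ym].
    rewrite /= oltNge; apply/negP => /ole_eqVlt[E|]; last by move/fi.
    by apply: nm; rewrite E; exists u.
  apply: contrapT => /mmin; rewrite oleNgt => /negP; exact.
Qed.

Lemma ord_ltP a b : (a < b)%ord <->
  exists f : a -> b, init_emb f /\ exists x, forall u, olt (f u) x.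
Proof.
split=> [ab|[f [fi [x fx]]]].
  have [f fi] : exists f : a -> b, init_emb f by apply/ord_leP; left.
  case: ab => x [g gm gr]; exists g; split; last first.
    exists x => u; suff : [set y | olt y x] (g u) by [].
    by rewrite -gr; exists u.
  split=> // u y yfu; rewrite gr /=; apply: olt_trans yfu _.
  suff : [set y | olt y x] (g u) by [].
  by rewrite -gr; exists u.
have [|m nm mmin] := @ord_min b [set y | ~ range f y].
  by exists x => -[u _ fux]; have := fx u; rewrite fux olt_irr.
exists m, f; first exact: fi.1.
apply/seteqP; split=> [_ [u _ <-]|y /= ym].
  rewrite /= oltNge; apply/negP => /ole_eqVlt[E|]; last by move/fi.2.
  by apply: nm; rewrite E; exists u.
apply: contrapT => /mmin; rewrite oleNgt => /negP; exact.
Qed.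

Lemma ord_le_refl a : (a <= a)%ord.
Proof. by apply/ord_leP; exists id; exact: init_emb_id. Qed.

Lemma ord_le_trans b a c : (a <= b)%ord -> (b <= c)%ord -> (a <= c)%ord.
Proof.
move=> /ord_leP[f fi] /ord_leP[g gi]; apply/ord_leP.
by exists (g \o f); exact: init_emb_comp.
Qed.

Lemma ord_ltW a b : (a < b)%ord -> (a <= b)%ord.
Proof. by left. Qed.

Lemma ord_le_lt_trans b a c : (a <= b)%ord -> (b < c)%ord -> (a < c)%ord.
Proof.
move=> /ord_leP[f fi] /ord_ltP[g [gi [x gx]]]; apply/ord_ltP.
exists (g \o f); split; first exact: init_emb_comp.
by exists x => u; exact: gx.
Qed.

Lemma ord_lt_le_trans b a c : (a < b)%ord -> (b <= c)%ord -> (a < c)%ord.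
Proof.
move=> /ord_ltP[f [fi [x fx]]] /ord_leP[g gi]; apply/ord_ltP.
exists (g \o f); split; first exact: init_emb_comp.
by exists (g x) => u; rewrite /= (mono_olt gi.1).
Qed.

Lemma ord_lt_trans b a c : (a < b)%ord -> (b < c)%ord -> (a < c)%ord.
Proof. by move=> /ord_ltW; exact: ord_le_lt_trans. Qed.

Lemma ord_lt_irr a : ~ (a < a)%ord.
Proof.
move=> [x [f fm fr]]; have : [set y | olt y x] (f x) by rewrite -fr; exists x.
by rewrite /= oltNge init_emb_ge.
Qed.

Lemma ord_iso_refl a : (a =~ a)%ord.
Proof. by exists id => //; exists id. Qed.

Lemma ord_iso_sym a b : (a =~ b)%ord -> (b =~ a)%ord.
Proof.
move=> [f [g fK gK] fm]; exists g; first by exists f.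
by move=> x y; rewrite -fm !gK.
Qed.

Lemma ord_iso_trans b a c : (a =~ b)%ord -> (b =~ c)%ord -> (a =~ c)%ord.
Proof.
move=> [f fb fm] [g gb gm]; exists (g \o f); first exact: bij_comp.
by move=> x y; rewrite /= gm fm.
Qed.

Lemma ord_iso_le a b : (a =~ b)%ord -> (a <= b)%ord.
Proof. by right. Qed.

Lemma ord_iso_ge a b : (a =~ b)%ord -> (b <= a)%ord.
Proof. by move/ord_iso_sym; right. Qed.

(** Comparability rests on matching the points of [a] and [b] whose initial
    segments are isomorphic. As a back-and-forth condition, the matching needs no
    isomorphism to be built: it is symmetric in [a] and [b] by definition, and
    well-founded induction makes it a partial function both ways. *)
Inductive same_rank (a b : ord) : a -> b -> Prop :=
| SameRank x y :
    (forall z, olt z x -> exists2 w, olt w y & same_rank z w) ->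
    (forall w, olt w y -> exists2 z, olt z x & same_rank z w) ->
    same_rank x y.

Lemma same_rankP (a b : ord) (x : a) (y : b) : same_rank x y ->
  (forall z, olt z x -> exists2 w, olt w y & same_rank z w) /\
  (forall w, olt w y -> exists2 z, olt z x & same_rank z w).
Proof. by case. Qed.

Lemma same_rank_sym (a b : ord) (x : a) (y : b) :
  same_rank x y -> same_rank y x.
Proof.
elim/olt_ind: x y => x IH y /same_rankP[xy yx].
constructor=> [w /yx[z zx zw]|z /[dup] zx /xy[w wy zw]]; [exists z|exists w] => //;
  exact: IH.
Qed.

Lemma same_rank_inj (a b : ord) (x : a) (y y' : b) :
  same_rank x y -> same_rank x y' -> y = y'.
Proof.
elim/olt_ind: x y y' => x IH.
have lt (y y' : b) : same_rank x y -> same_rank x y' -> ~ olt y y'.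
  move=> /same_rankP[xy _] /same_rankP[_ y'x] /y'x[z zx zy].
  have [w wy zw] := xy _ zx; have E := IH _ zx _ _ zy zw.
  by rewrite -E olt_irr in wy.
move=> y y' xy xy'; apply: ole_anti; rewrite oleNgt; apply/negP; exact: lt.
Qed.

Lemma same_rank_emb (a b : ord) :
  (forall x : a, exists y : b, same_rank x y) -> (a <= b)%ord.
Proof.
move=> /choice[f fP]; apply/ord_leP; exists f.
have lt x y : olt x y -> olt (f x) (f y).
  move=> xy; have [/(_ _ xy)[v vw xv] _] := same_rankP (fP y).
  by rewrite (same_rank_inj (fP x) xv).
split=> [|x y yx]; first exact: olt_mono.
have [_ /(_ _ yx)[z zx zy]] := same_rankP (fP x).
by exists z => //; exact: same_rank_inj (fP z) zy.
Qed.

(** A point [x0] of [a] that is minimal without a match has a match as soon as some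
    [y] in [b] is not matched below [x0]; so either all of [a] or all of [b] is
    matched. *)
Lemma ord_le_total a b : (a <= b)%ord \/ (b <= a)%ord.
Proof.
have [|/existsNP[x nx]] := pselect (forall x : a, exists y : b, same_rank x y).
  by left; exact: same_rank_emb.
right; apply: same_rank_emb => y.
suff [z _ zy] : exists2 z : a, olt z x & same_rank z y.
  by exists z; exact: same_rank_sym.
have [|x0 nx0 x0min] := @ord_min a [set x | ~ exists y : b, same_rank x y].
  by exists x.
have below z : olt z x0 -> exists w : b, same_rank z w.
  by move=> zx; apply: contrapT => nz; have := x0min z nz; rewrite oleNgt zx.
suff H : exists2 z : a, olt z x0 & same_rank z y.
  case: H => z zx0 zy; exists z => //; apply: olt_le_trans zx0 (x0min _ nx).
elim/olt_ind: y => y IH; apply: contrapT => ny; apply: nx0; exists y.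
constructor=> // z zx0; have [w zw] := below _ zx0; exists w => //.
rewrite oltNge; apply/negP => /ole_eqVlt[E|yw].
  by apply: ny; exists z; rewrite ?E.
have [_ /(_ _ yw)[v vz vy]] := same_rankP zw; apply: ny.
by exists v => //; exact: olt_trans zx0.
Qed.

Lemma ord_lt_or_ge a b : (a < b)%ord \/ (b <= a)%ord.
Proof.
by have [[|/ord_iso_ge]|] := ord_le_total a b; [left|right|right].
Qed.

Lemma ord_le_eqVlt a b : (a <= b)%ord -> (a =~ b)%ord \/ (a < b)%ord.
Proof. by case; [right|left]. Qed.

Lemma ord_le_iso a b : (a <= b)%ord -> (b <= a)%ord -> (a =~ b)%ord.
Proof. by move=> [ab /(ord_lt_le_trans ab)/ord_lt_irr|]. Qed.

Lemma oseg_lt (a : ord) (x : a) : (oseg x < a)%ord.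
Proof.
exists x, val => //; apply/seteqP; split=> [_ [[u ux] _ <-] //|y yx].
by exists (exist _ y yx).
Qed.

Lemma ord_lt_seg a b : (b < a)%ord -> exists x : a, (b =~ oseg x)%ord.
Proof.
move=> [x [f fm fr]]; exists x.
have fx u : olt (f u) x.
  by suff : [set y | olt y x] (f u) by []; rewrite -fr; exists u.
exists (fun u => exist (fun y => olt y x) (f u) (fx u)) => //.
rewrite -setTT_bijective; split=> //.
  by move=> u v _ _ [] /(mono_inj fm).
move=> [y yx] _; have : range f y by rewrite fr.
by case=> u _ uy; exists u => //; exact: val_inj.
Qed.

Lemma olt_seg (a : ord) (x : a) (u v : oseg x) : olt u v = olt (val u) (val v).
Proof. by rewrite !oltNge. Qed.

Lemma oseg_mono (a : ord) (x y : a) : ole x y -> (oseg x <= oseg y)%ord.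
Proof.
move=> xy; apply/ord_leP.
exists (fun u : oseg x => exist (fun z => olt z y) (val u) (olt_le_trans (valP u) xy)).
split=> // u w; rewrite olt_seg => wu.
have wx : olt (val w) x := olt_trans wu (valP u).
by exists (exist _ (val w) wx) => //; exact: val_inj.
Qed.

Lemma oseg_lt_mono (a : ord) (x y : a) : olt x y -> (oseg x < oseg y)%ord.
Proof.
move=> xy; have [//|/ord_leP[f [fm _]]] := ord_lt_or_ge (oseg x) (oseg y).
pose k (u : oseg y) : oseg y :=
  exist (fun z => olt z y) (val (f u)) (olt_trans (valP (f u)) xy).
have /(_ (exist _ x xy)) := @init_emb_ge (oseg y) k fm.
by rewrite oleNgt olt_seg (valP (f _)).
Qed.

Lemma ord_lt_ind (P : ord -> Prop) :
  (forall a, (forall b, (b < a)%ord -> P b) -> P a) -> forall a, P a.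
Proof.
move=> IH a; apply: (IH) => b /ord_lt_seg[x]; elim/olt_ind: x b => x IHx b bx.
apply: (IH) => c cb; have cx := ord_lt_le_trans cb (ord_iso_le bx).
have [y cy] := ord_lt_seg (ord_lt_trans cx (oseg_lt x)).
apply: (IHx y _ _ cy); rewrite oltNge; apply/negP => /oseg_mono xy.
apply: (@ord_lt_irr c); apply: ord_lt_le_trans cx _; apply: ord_le_trans xy _.
exact: ord_iso_ge cy.
Qed.

(** * Successors, limits and parity *)

Definition osucc (a : ord) : ord := oadd a (ofin 1).

(** Isomorphisms with a successor are obtained from this characterization: a last
    element [x], and a copy of [a] below it. *)
Lemma osuccP (a b : ord) (x : b) (f : a -> b) :
  (forall y, ole y x) -> {mono f : u v / ole u v} -> range f = [set y | olt y x] ->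
  (b =~ osucc a)%ord.
Proof.
move=> xmax fm fr.
have fx u : olt (f u) x.
  by suff : [set y | olt y x] (f u) by []; rewrite -fr; exists u.
pose g (u : osucc a) := match u with inl v => f v | inr _ => x end.
apply: ord_iso_sym; exists g.
  rewrite -setTT_bijective; split=> //.
    move=> [u|i] [v|j] _ _ /=; first by move/(mono_inj fm) ->.
    - by move=> E; have := fx u; rewrite E olt_irr.
    - by move=> E; have := fx v; rewrite -E olt_irr.
    - by rewrite (ord1 i) (ord1 j).
  move=> y _; case: (ole_eqVlt (xmax y)) => [->|yx]; first by exists (inr ord0).
  have : range f y by rewrite fr.
  by case=> u _ <-; exists (inl u).
move=> [u|i] [v|j] /=.
- exact: fm.
- exact: oltW.
- by rewrite oleNgt fx.
- by rewrite ole_refl (ord1 i) (ord1 j) /=.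
Qed.

Lemma ord_lt_succ (a : ord) : (a < osucc a)%ord.
Proof.
apply/ord_ltP; exists inl; split; last by exists (inr ord0).
by split=> // u [y|i] // _; exists y.
Qed.

Lemma osucc_le (a b : ord) : (a < b)%ord -> (osucc a <= b)%ord.
Proof.
move=> /ord_ltP[f [fi [x0 fx0]]].
have [|x fx xmin] := @ord_min b [set x | forall u, olt (f u) x]; first by exists x0.
apply/ord_leP; exists (fun u : osucc a => match u with inl v => f v | inr _ => x end).
split=> [[u|i] [v|j] /=|[u|i] y /=].
- exact: fi.1.
- by rewrite (oltW (fx u)).
- by rewrite oleNgt fx.
- by rewrite ole_refl (ord1 i) (ord1 j).
- by move=> /fi.2[v _ <-]; exists (inl v).
- move=> yx; apply: contrapT => ny.
  suff /xmin : forall u, olt (f u) y by rewrite oleNgt yx.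
  move=> u; rewrite oltNge; apply/negP => /ole_eqVlt[E|/fi.2[v _ vy]]; apply: ny.
    by exists (inl u).
  by exists (inl v).
Qed.

Lemma ord_lt_succP (a b : ord) : (b < osucc a)%ord <-> (b <= a)%ord.
Proof.
split=> [ba|ba]; last exact: ord_le_lt_trans ba (ord_lt_succ a).
have [/osucc_le ab|//] := ord_lt_or_ge a b.
by case: (@ord_lt_irr b); exact: ord_lt_le_trans ba ab.
Qed.

Lemma osucc_mono (a b : ord) : (a <= b)%ord -> (osucc a <= osucc b)%ord.
Proof. by move=> /ord_lt_succP/osucc_le. Qed.

Lemma osucc_iso (a b : ord) : (a =~ b)%ord -> (osucc a =~ osucc b)%ord.
Proof.
by move=> ab; apply: ord_le_iso; apply: osucc_mono; [exact: ord_iso_le|exact: ord_iso_ge].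
Qed.

Lemma is_limit_succ (l b : ord) : is_limit l -> (b < l)%ord -> (osucc b < l)%ord.
Proof.
move=> [_ lim] /[dup] /osucc_le bl /ord_ltP[f [fi [x fx]]].
have [//|lb] := ord_lt_or_ge (osucc b) l.
have [g [h gK hK] gm] := ord_le_iso bl lb.
have [y] := lim (g (inr ord0)); rewrite -(hK y) (mono_olt gm).
by case: (h y) => // i; rewrite (ord1 i) olt_irr.
Qed.

Lemma ofin1_le (a : ord) (x : a) : (ofin 1 <= a)%ord.
Proof.
have [|m _ mmin] := @ord_min a setT; first by exists x.
apply/ord_leP; exists (fun=> m); split=> [i j|_ y].
  by rewrite ole_refl (ord1 i) (ord1 j) /=.
by rewrite oltNge mmin.
Qed.

Lemma ofin1_inh (a : ord) : (ofin 1 <= a)%ord -> [set: a] !=set0.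
Proof. by move=> /ord_leP[f _]; exists (f ord0). Qed.

Lemma ofin_succ n : (ofin n.+1 =~ osucc (ofin n))%ord.
Proof.
apply: (@osuccP (ofin n) (ofin n.+1) ord_max (widen_ord (leqnSn n))) => [i||] //.
  exact: leq_ord.
apply/seteqP; split=> [_ [i _ <-]|i]; first by rewrite /= oltNge /= -ltnNge.
by rewrite /= oltNge /= -ltnNge => lt_i; exists (Ordinal lt_i) => //; exact: val_inj.
Qed.

Lemma ofin1_lt2 : (ofin 1 < ofin 2)%ord.
Proof. exact: ord_lt_le_trans (ord_lt_succ _) (ord_iso_ge (ofin_succ 1)). Qed.

(** The parity of [alpha], read on the level [1 + alpha] of the hierarchy. Generating
    it by these rules gives the induction along which the classes are computed. *)
Inductive even_level : ord -> Prop :=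
| EvenLevelOne a : (a =~ ofin 1)%ord -> even_level a
| EvenLevelLim a : is_limit a -> even_level a
| EvenLevelSucc a b : even_level b -> (a =~ osucc (osucc b))%ord -> even_level a.

Definition odd_level (a : ord) := exists2 b, even_level b & (a =~ osucc b)%ord.

Lemma level_ge1 a : even_level a -> (ofin 1 <= a)%ord.
Proof.
move=> [b /ord_iso_ge //|b [[x _] _]|b c _ bc]; first exact: ofin1_le x.
apply: ord_le_trans (ord_iso_ge bc); exact: (@ofin1_le (osucc _) (inr ord0)).
Qed.

Lemma even_or_odd_level (a : ord) : (ofin 1 <= a)%ord -> even_level a \/ odd_level a.
Proof.
elim/ord_lt_ind: a => a IH a1; have [x0 _] := ofin1_inh a1.
have [[x xmax]|nomax] := pselect (exists x : a, forall y, ole y x); last first.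
  left; apply: EvenLevelLim; split=> [|x]; first by exists x0.
  apply: contrapT => nx; apply: nomax; exists x => y; rewrite oleNgt.
  by apply/negP => xy; apply: nx; exists y.
have ax : (a =~ osucc (oseg x))%ord.
  apply: (@osuccP (oseg x) a x val xmax) => //.
  apply/seteqP; split=> [_ [[u ux] _ <-] //|y yx].
  by exists (exist _ y yx).
have [[y yx]|noy] := pselect (exists y, olt y x).
  case: (IH (oseg x) (oseg_lt x)); first exact: (@ofin1_le (oseg x) (exist _ y yx)).
    by right; exists (oseg x).
  move=> [b bE xb]; left; apply: (EvenLevelSucc bE).
  exact: ord_iso_trans ax (osucc_iso xb).
left; apply: EvenLevelOne; apply: ord_iso_sym; exists (fun=> x).
  exists (fun=> ord0) => [i|y]; first by rewrite (ord1 i).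
  by case: (ole_eqVlt (xmax y)) => // yx; case: noy; exists y.
by move=> i j; rewrite ole_refl (ord1 i) (ord1 j).
Qed.

(** The successor of [b] or the successor of that successor is even, and a limit
    is not reached in two steps. *)
Lemma even_level_cofinal (l b : ord) : is_limit l -> (b < l)%ord ->
  exists c, [/\ even_level c, (b <= c)%ord & (c < l)%ord].
Proof.
move=> ll bl; have bl' := is_limit_succ ll bl.
have [|sE|[c cE bc]] := @even_or_odd_level (osucc b).
- exact: (@ofin1_le (osucc _) (inr ord0)).
- by exists (osucc b); split=> //; left; exact: ord_lt_succ.
- exists (osucc (osucc c)); split; first exact: (EvenLevelSucc cE (ord_iso_refl _)).
    apply: (@ord_le_trans (osucc b)); first by left; exact: ord_lt_succ.
    apply: ord_le_trans (ord_iso_le bc) _; left; exact: ord_lt_succ.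
  by apply: is_limit_succ => //; exact: ord_le_lt_trans (ord_iso_ge bc) bl'.
Qed.

Lemma oadd_succ (l : ord) n :
  (oadd (ofin 1) (oadd l (ofin n.+1)) =~ osucc (oadd (ofin 1) (oadd l (ofin n))))%ord.
Proof.
pose f (u : oadd (ofin 1) (oadd l (ofin n))) : oadd (ofin 1) (oadd l (ofin n.+1)) :=
  match u with
  | inl i => inl i | inr (inl v) => inr (inl v)
  | inr (inr j) => inr (inr (widen_ord (leqnSn n) j)) end.
set b := oadd _ (oadd l (ofin n.+1)).
refine (@osuccP _ b (inr (inr ord_max)) f _ _ _).
- by move=> [i|[v|j]] //=; rewrite -ltnS.
- by move=> [i|[v|j]] [i'|[v'|j']].
- apply/seteqP; split=> [_ [[i|[v|j]] _ <-]|[i|[v|j]]] //=.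
  + by rewrite oltNge /= -ltnNge.
  + by exists (inl i).
  + by exists (inr (inl v)).
  + rewrite oltNge /= -ltnNge => jn; exists (inr (inr (Ordinal jn))) => //.
    by congr (inr (inr _)); exact: val_inj.
Qed.

Lemma oadd_iso (c a b : ord) : (a =~ b)%ord -> (oadd c a =~ oadd c b)%ord.
Proof.
move=> [f [g fK gK] fm].
exists (fun u => match u with inl v => inl v | inr v => inr (f v) end).
  by exists (fun u => match u with inl v => inl v | inr v => inr (g v) end) => -[u|u] //;
    congr inr.
by move=> [u|u] [v|v] //=; exact: fm.
Qed.

Lemma even_level_add (l : ord) n : (l =~ ofin 0)%ord \/ is_limit l ->
  let a := oadd (ofin 1) (oadd l (ofin n)) in
  if odd n then odd_level a else even_level a.
Proof.
move=> ll; elim: n => [|n IH] /=.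
  case: ll => [[f _ _]|[[x0 _] lim]].
    apply: EvenLevelOne; apply: ord_iso_sym; exists inl.
      exists (fun u => match u with inl i => i | _ => ord0 end) => // -[i|[v|[]]] //.
      by case: (f v).
    by [].
  apply: EvenLevelLim; split; first by exists (inr (inl x0)).
  move=> [i|[v|[]//]]; first by exists (inr (inl x0)); rewrite oltNge.
  have [w vw] := lim v; exists (inr (inl w)); rewrite oltNge /=.
  by rewrite -oltNge.
have sE := oadd_succ l n.
case: (odd n) IH => /= [[b bE ab]|aE].
  apply: (EvenLevelSucc bE); apply: ord_iso_trans sE _; exact: osucc_iso.
by exists (oadd (ofin 1) (oadd l (ofin n))).
Qed.

Lemma even_level_iso a b : (a =~ b)%ord -> even_level b -> even_level a.
Proof.
move=> ab bE; case: b / bE ab => [b b1|b bl|b c cE bc] ab.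
- exact: EvenLevelOne (ord_iso_trans ab b1).
- case: ab => f [g fK gK] fm; case: bl => [[x _] lim]; apply: EvenLevelLim; split.
    by exists (g x).
  move=> y; have [z yz] := lim (f y); exists (g z).
  by rewrite -(mono_olt fm) gK.
- exact: EvenLevelSucc cE (ord_iso_trans ab bc).
Qed.

Lemma even_ord_level (alpha : ord) : even_ord alpha -> even_level (ofin 1 + alpha)%ord.
Proof.
move=> [l [n [ll al en]]]; have := even_level_add n ll; rewrite (negbTE en) /=.
exact: even_level_iso (oadd_iso _ al).
Qed.

Lemma odd_ord_level (alpha : ord) : odd_ord alpha -> odd_level (ofin 1 + alpha)%ord.
Proof.
move=> [l [n [ll al on]]]; have := even_level_add n ll; rewrite on /= => -[b bE ab].
exists b => //; exact: ord_iso_trans (oadd_iso _ al) ab.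
Qed.

(** * Infinite cardinal arithmetic *)

Lemma card_leTP (S T : Type) :
  [set: S] #<= [set: T] <-> exists f : S -> T, injective f.
Proof.
split=> [/card_leP/injfunPex[f _ finj]|[f finj]].
  have inS x : x \in [set: S] by rewrite inE.
  exists (fun x => set_val (f (SigSub (inS x)))) => x y /val_inj.
  by move/finj => /(_ (mem_setT _) (mem_setT _)) /(congr1 val).
have fS : f @` [set: S] #= [set: S] by apply: inj_card_eq => x y _ _; exact: finj.
by rewrite -(card_le_eql fS); exact: card_leT.
Qed.

Lemma finite_setTP (S T : Type) :
  finite_set [set: S] -> finite_set [set: T] -> finite_set [set: S * T].
Proof. by move=> fS fT; rewrite -setXTT; exact: finite_setX. Qed.

Lemma card_le_prod (S S' T T' : Type) : [set: S] #<= [set: S'] ->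
  [set: T] #<= [set: T'] -> [set: S * T] #<= [set: S' * T'].
Proof.
move=> /card_leTP[f finj] /card_leTP[g ginj]; apply/card_leTP.
by exists (fun u => (f u.1, g u.2)) => -[x y] [x' y'] [/finj-> /ginj->].
Qed.

Lemma card_le_exp (S S' T T' : Type) : [set: S] #<= [set: S'] ->
  [set: T] #<= [set: T'] -> [set: S' -> T] #<= [set: S' -> T'].
Proof.
move=> /card_leTP[f finj] /card_leTP[g ginj]; apply/card_leTP.
exists (fun u x => g (u x)) => u v uv; apply/funext => x; apply: ginj.
exact: (congr1 (fun w => w x) uv).
Qed.

Lemma ord_le_card (a b : ord) : (a <= b)%ord -> [set: a] #<= [set: b].
Proof. by move=> /ord_leP[f [/mono_inj fi _]]; apply/card_leTP; exists f. Qed.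

(** Hilbert's hotel, along a copy of the natural numbers. *)
Lemma card_le_option (S : Type) : infinite_set [set: S] ->
  [set: option S] #<= [set: S].
Proof.
move=> /infiniteP/card_leTP[g ginj]; apply/card_leTP.
have [h hE] : exists h : S -> S, (forall n, h (g n) = g n.+1) /\
    (forall x, ~ range g x -> h x = x).
  exists (fun x => if pselect (range g x) is left e
    then g (projT1 (cid2 e)).+1 else x); split=> [n|x nx].
    case: pselect => [e|[]]; last by exists n.
    by case: (cid2 e) => m _ /= /ginj ->.
  by case: pselect.
case: hE => hg hid; pose k (x : option S) := if x is Some y then h y else g 0%N.
have rg x : range g x \/ ~ range g x by exact: EM.
have h0 x : h x <> g 0%N.
  case: (rg x) => [[n _ <-]|nx]; first by rewrite hg => /ginj.
  by rewrite hid // => x0; apply: nx; exists 0%N.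
exists k => -[x|] [y|] //=; last 2 first.
- by move/h0.
- by move/esym/h0.
case: (rg x) (rg y) => [[n _ <-]|nx] [[m _ <-]|ny].
- by rewrite !hg => /ginj[->].
- by rewrite hg (hid y) // => E; case: ny; exists n.+1.
- by rewrite hg (hid x) // => E; case: nx; exists m.+1.
- by rewrite !hid // => ->.
Qed.

(** An infinite ordinal that no smaller one dominates has no last element, as
    otherwise removing it would not change the cardinality. *)
Lemma initial_nomax (a : ord) : infinite_set [set: a] ->
  (forall b, (b < a)%ord -> ~ ([set: a] #<= [set: b])) ->
  forall x : a, exists y, olt x y.
Proof.
move=> ainf amin x; apply: contrapT => nx; apply: (amin _ (oseg_lt x)).
have xmax y : y <> x -> olt y x.
  move=> yx; rewrite oltNge; apply/negP => /ole_eqVlt[/esym //|xy].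
  by apply: nx; exists y.
have ao : [set: a] #<= [set: option (oseg x)].
  apply/card_leTP; exists (fun y => if pselect (y = x) is right e
    then Some (exist (fun y => olt y x) y (xmax y e)) else None).
  move=> y z; case: pselect => [->|yx]; case: pselect => [->|zx] //.
  by move=> [].
apply: (card_le_trans ao); apply: card_le_option => fin.
apply: ainf; apply: card_le_finite ao _.
apply: card_le_finite (_ : [set: option (oseg x)] #<= None |` (Some @` [set: oseg x])) _.
  by apply: subset_card_le => -[y|] _; [right; exists y | left].
rewrite finite_setU; split; first exact: finite_set1.
exact: finite_image.
Qed.

(** Goedel's ordering of pairs. Comparing maxima first bounds each proper initial
    segment by the square of a proper initial segment of [a]. *)
Section Godel.
Variable a : ord.
Implicit Types u v w : a * a.

Definition godel_le u v :=
  [|| olt (omax u.1 u.2) (omax v.1 v.2) |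
   (omax u.1 u.2 == omax v.1 v.2) &&
   (olt u.1 v.1 || (u.1 == v.1) && ole u.2 v.2)].

Lemma godel_wo : well_order godel_le.
Proof.
apply: antisymmetric_well_order => [[u1 u2] [v1 v2]|A [u Au]].
  rewrite /godel_le /=; set m := omax _ _; set n := omax _ _.
  have lt_asym (x y : a) : olt x y -> olt y x -> False.
    by move=> xy /(olt_trans xy); rewrite olt_irr.
  move=> /andP[]; case/orP => [mn|/andP[/eqP mn]].
    case/orP => [/(lt_asym _ _ mn) //|/andP[/eqP E]].
    by rewrite E olt_irr in mn.
  rewrite mn olt_irr eqxx /=; case/orP => [uv|/andP[/eqP -> uv]].
    case/orP => [/(lt_asym _ _ uv) //|/andP[/eqP E]].
    by rewrite E olt_irr in uv.
  by rewrite olt_irr eqxx /= => vu; congr pair; exact: ole_anti.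
have [|m [v Av vm] mmin] := @ord_min a [set omax u.1 u.2 | u in [set u | u \in A]].
  by exists (omax u.1 u.2), u.
have [|x [w [/= Aw wm] wx] xmin] := @ord_min a
  [set u.1 | u in [set u | u \in A /\ omax u.1 u.2 = m]].
  by exists v.1, v.
have [|y [t [/= At tm tx] ty] ymin] := @ord_min a
  [set u.2 | u in [set u | [/\ u \in A, omax u.1 u.2 = m & u.1 = x]]].
  by exists w.2, w.
exists t; split=> // s As; rewrite /godel_le tm tx ty.
have ms : ole m (omax s.1 s.2) by apply: mmin; exists s.
case: (ole_eqVlt ms) => [E|->//]; rewrite -E eqxx olt_irr /=.
have xs : ole x s.1 by apply: xmin; exists s.
case: (ole_eqVlt xs) => [E'|->//]; rewrite -E' eqxx olt_irr /=.
by apply: ymin; exists s.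
Qed.

Definition godel : ord := @Ord (a * a)%type godel_le godel_wo.

Lemma godel_lt (x y z : a) : olt y z -> @olt godel (x, y) (x, z).
Proof.
move=> yz; have nzy : ~~ ole z y by rewrite -oltNge.
rewrite oltNge /= /godel_le /= negb_or -oleNgt.
have xyz : ole (omax x y) (omax x z).
  apply: omax_lub; first exact: omaxl.
  exact: ole_trans (oltW yz) (omaxr _ _).
by rewrite xyz olt_irr eqxx (negbTE nzy) /= andbF.
Qed.

(** A proper initial segment of Goedel's ordering lies in a square of a proper
    initial segment, hence is too small to contain a copy of [a]. *)
Lemma godel_ord_le : infinite_set [set: a] ->
  (forall b, (b < a)%ord -> ~ ([set: a] #<= [set: b])) ->
  (forall b, (b < a)%ord -> infinite_set [set: b] -> [set: b * b] #<= [set: b]) ->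
  (godel <= a)%ord.
Proof.
move=> ainf amin asq; case: (ord_lt_or_ge a godel) => // /ord_ltP[f [[fm _] [v fv]]].
have [m vm] := initial_nomax ainf amin (omax v.1 v.2).
have below x : olt (f x).1 m /\ olt (f x).2 m.
  have fxm : olt (omax (f x).1 (f x).2) m.
    apply: ole_lt_trans vm; have := fv x; rewrite oltNge /= /godel_le negb_or.
    by rewrite -oleNgt => /andP[].
  split; apply: ole_lt_trans fxm; [exact: omaxl|exact: omaxr].
have sq : [set: a] #<= [set: oseg m * oseg m].
  apply/card_leTP; pose g i p : oseg m := exist (fun y => olt y m) i p.
  exists (fun x => (g _ (below x).1, g _ (below x).2)) => x y [E1 E2].
  by apply: (mono_inj fm); apply: injective_projections.
have [fin|inf] := pselect (finite_set [set: oseg m]).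
  case: ainf; apply: card_le_finite sq _; exact: finite_setTP.
case: (amin _ (oseg_lt m)); apply: card_le_trans sq _.
exact: asq (oseg_lt m) inf.
Qed.

End Godel.

(** By induction on the least ordinal of the given cardinality, which Goedel's
    ordering of its pairs cannot exceed. *)
Lemma card_square (S : Type) : infinite_set [set: S] ->
  [set: S * S] #<= [set: S].
Proof.
suff sq (a : ord) : infinite_set [set: a] -> [set: a * a] #<= [set: a].
  have [R Rwo] := well_ordering_principle {classic S}.
  exact: (sq (Ord Rwo)).
elim/ord_lt_ind: a => a IH ainf.
have [[b ba ab]|nb] := pselect (exists2 b, (b < a)%ord & [set: a] #<= [set: b]).
  have ba' := ord_le_card (ord_ltW ba).
  apply: card_le_trans (card_le_prod ab ab) _; apply: card_le_trans ba'.
  by apply: IH => // /(card_le_finite ab).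
apply: (@ord_le_card (godel a)); apply: godel_ord_le => // b ba ab.
by apply: nb; exists b.
Qed.

(** The least ordinal with the cardinality of [a] is a cardinal; if it exceeded
    [k], then [kp] would be at most [a]. *)
Lemma succ_cardinal_card (k kp a : ord) : is_succ_cardinal k kp -> (a < kp)%ord ->
  [set: a] #<= [set: k].
Proof.
move=> [_ _ kpmin] akp.
suff H (e : ord) : (e <= a)%ord -> [set: a] #<= [set: e] -> [set: a] #<= [set: k].
  exact: H (ord_le_refl a) (card_lexx _).
elim/ord_lt_ind: e => e IH ea ae.
have [[b be eb]|nb] := pselect (exists2 b, (b < e)%ord & [set: e] #<= [set: b]).
  apply: (IH b be); last exact: card_le_trans eb.
  by left; exact: ord_lt_le_trans ea.
have [ke|/ord_le_card] := ord_lt_or_ge k e; last exact: card_le_trans.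
suff /kpmin /(_ ke) kpe : is_cardinal e.
  by case: (@ord_lt_irr a); exact: ord_lt_le_trans akp (ord_le_trans kpe ea).
move=> d de; apply/negP; rewrite card_eq_le => /andP[_ ed].
by apply: nb; exists d.
Qed.

(** * Sets of size less than kappa *)

Section Small.
Variables kappa mu : ord.
Hypothesis kappa_card : is_cardinal kappa.
Hypothesis kappa_unc : ~ countable [set: kappa].
Hypothesis mu_cof : is_cofinality kappa mu.
Hypothesis kappa_sing : (mu < kappa)%ord.
Hypothesis pow_kappa : [set: bseq_lt kappa] #= [set: kappa].

Definition small (S : Type) : Prop :=
  exists x : kappa, [set: S] #<= [set: oseg x].

Let kappa_inf : infinite_set [set: kappa].
Proof. by move/finite_set_countable. Qed.

Lemma cardinal_min (b : ord) : (b < kappa)%ord -> ~ ([set: kappa] #<= [set: b]).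
Proof.
move=> bk kb; have /negP := kappa_card bk; apply; rewrite card_eq_le kb andbT.
exact: ord_le_card (ord_ltW bk).
Qed.

Lemma kappa_nomax (x : kappa) : exists y, olt x y.
Proof. exact: initial_nomax kappa_inf cardinal_min x. Qed.

Lemma ord_small (d : ord) : (d < kappa)%ord -> small d.
Proof. by move=> /ord_lt_seg[x /ord_iso_le/ord_le_card]; exists x. Qed.

Lemma seg_small (x : kappa) : small (oseg x).
Proof. by exists x. Qed.

Lemma small_le (S T : Type) : [set: S] #<= [set: T] -> small T -> small S.
Proof. by move=> ST [x Tx]; exists x; exact: card_le_trans Tx. Qed.

Lemma small_inj (S T : Type) (f : S -> T) : injective f -> small T -> small S.
Proof. by move=> fi; apply: small_le; apply/card_leTP; exists f. Qed.

Lemma small_le_kappa (S : Type) : small S -> [set: S] #<= [set: kappa].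
Proof.
move=> [x Sx]; apply: card_le_trans Sx _.
exact: ord_le_card (ord_ltW (oseg_lt x)).
Qed.

Lemma small_or_ge (S : Type) : small S \/ [set: kappa] #<= [set: S].
Proof.
have [R Rwo] := well_ordering_principle {classic S}.
case: (ord_lt_or_ge (Ord Rwo) kappa) => [/ord_small|/ord_le_card]; by [left|right].
Qed.

(** Otherwise [kappa] would be a union of finite sets over the set [mu], which
    embeds in a proper segment and would be finite as well. *)
Lemma infinite_seg : exists x : kappa, infinite_set [set: oseg x].
Proof.
apply: contrapT => nx.
have fin (x : kappa) : finite_set [set: oseg x].
  by apply: contrapT => xinf; apply: nx; exists x.
apply: kappa_inf; have [[f fcof] _] := mu_cof.
have [x mx] := ord_small kappa_sing.
apply: (@sub_finite_set _ _ (\bigcup_i [set y | ole y (f i)])).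
  by move=> y _; have [i yi] := fcof y; exists i.
apply: bigcup_finite => [|i _]; first exact: card_le_finite mx (fin x).
have [z fz] := kappa_nomax (f i).
apply: (@sub_finite_set _ _ (val @` [set: oseg z])); last exact: finite_image.
by move=> y yf; exists (exist _ y (ole_lt_trans yf fz)).
Qed.

Lemma small_prod (S T : Type) : small S -> small T -> small (S * T).
Proof.
move=> [x Sx] [y Ty]; have [z zinf] := infinite_seg.
pose w := omax x (omax y z).
have xw : (oseg x <= oseg w)%ord by apply: oseg_mono; exact: omaxl.
have yw : (oseg y <= oseg w)%ord.
  by apply: oseg_mono; apply: ole_trans (omaxl _ _) (omaxr _ _).
have zw : (oseg z <= oseg w)%ord.
  by apply: oseg_mono; apply: ole_trans (omaxr _ _) (omaxr _ _).
exists w; apply: card_le_trans (card_square _); last first.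
  by move/(card_le_finite (ord_le_card zw)).
apply: card_le_prod; first exact: card_le_trans Sx (ord_le_card xw).
exact: card_le_trans Ty (ord_le_card yw).
Qed.

(** Koenig's diagonal argument: if [G] codes functions by elements of [kappa],
    the functions coded below [f i] do not take all values at [i]. *)
Lemma konig : ~ ([set: mu -> kappa] #<= [set: kappa]).
Proof.
move=> /card_leTP[G Ginj]; have [[f fcof] _] := mu_cof.
have H i : exists y, forall k : mu -> kappa, ole (G k) (f i) -> k i <> y.
  apply: contrapT => ny.
  have /choice[K KP] y : exists k : mu -> kappa, ole (G k) (f i) /\ k i = y.
    apply: contrapT => nk; apply: ny; exists y => k Gk ky.
    by apply: nk; exists k.
  have [z fz] := kappa_nomax (f i).
  apply: (cardinal_min (oseg_lt z)); apply/card_leTP.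
  exists (fun y => exist (fun x => olt x z) (G (K y)) (ole_lt_trans (KP y).1 fz)).
  by move=> y y' [] /Ginj E; rewrite -(KP y).2 -(KP y').2 E.
have [h hP] := choice H; have [i hi] := fcof (G h).
exact: hP hi _.
Qed.

Lemma card_le_pow (S T : Type) : [set: S] #<= [set: T] ->
  [set: S -> bool] #<= [set: T -> bool].
Proof.
move=> /card_leTP[f finj]; apply/card_leTP.
exists (fun h t => `[< exists2 s, f s = t & h s >]) => h k hk.
apply/funext => s; have := congr1 (fun w => w (f s)) hk.
have E (l : S -> bool) : `[< exists2 s', f s' = f s & l s' >] = l s.
  by apply/asboolP/idP => [[s' /finj ->]//|ls]; exists s.
by rewrite !E.
Qed.

(** If [S -> T] had size at least [kappa], then [kappa ^ mu] would be at most
    [2 ^ (mu * S * T)], which is at most [2 ^ (< kappa) = kappa]. *)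
Lemma small_exp (S T : Type) : small S -> small T -> small (S -> T).
Proof.
move=> sS sT; case: (small_or_ge (S -> T)) => // kST; case: konig.
have [x xP] : small ((mu * S) * T).
  by apply: small_prod => //; apply: small_prod => //; exact: ord_small.
apply: (card_le_trans (card_le_exp (card_lexx [set: mu]) kST)).
have /card_eqPle[pk _] := pow_kappa; apply: card_le_trans pk.
apply: (@card_le_trans _ _ _ [set: oseg x -> bool]); last first.
  apply/card_leTP; exists (fun s => existT _ x s) => s t.
  exact: eq_from_Tagged.
apply: card_le_trans (card_le_pow xP); apply/card_leTP.
exists (fun h u => `[< h u.1.1 u.1.2 = u.2 >]) => h k hk.
apply/funext => i; apply/funext => s; apply/esym/asboolP.
by have /= <- := congr1 (fun w => w (i, s, h i s)) hk; apply/asboolP.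
Qed.

(** Goedel's ordering of the pairs of elements of [kappa] has type at most
    [kappa]. Monotonicity in the second argument makes the coordinate maps that
    the pairing induces on the Cantor space continuous. *)
Lemma pairing : exists p : kappa -> kappa -> kappa,
  (forall x y x' y', p x y = p x' y' -> x = x' /\ y = y') /\
  (forall x, {mono p x : y z / ole y z}).
Proof.
have : (godel kappa <= kappa)%ord.
  apply: godel_ord_le => //; first exact: cardinal_min.
  by move=> b _; exact: card_square.
move=> /ord_leP[f [fm _]]; exists (fun x y => f (x, y)); split.
  by move=> x y x' y' /(mono_inj fm)[].
move=> x; apply: olt_mono => y z /(godel_lt x).
by rewrite -(mono_olt fm).
Qed.

(** Through an injection in [kappa], which has cofinality [mu], [l] is a union of
    [mu] many small sets: either one of them is cofinal in [l], or all of them are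
    bounded and their bounds are cofinal. *)
Lemma small_cofinal (l : ord) : [set: l] #<= [set: kappa] -> is_limit l ->
  exists N : Type, small N /\ exists g : N -> l, forall x, exists n, olt x (g n).
Proof.
move=> /card_leTP[h hinj] [[x0 _] lim]; have [[f fcof] _] := mu_cof.
have [[i bi]|nb] := pselect (exists i, forall x, exists2 y, olt x y & ole (h y) (f i)).
  have [z fz] := kappa_nomax (f i).
  exists {y | ole (h y) (f i)}; split.
    apply: (small_inj (f := fun y : {y | ole (h y) (f i)} =>
      exist (fun x => olt x z) (h (val y)) (ole_lt_trans (valP y) fz))); last exact: seg_small.
    by move=> y y' [] /hinj/val_inj.
  exists val => x; have [y xy yi] := bi x.
  by exists (exist _ y yi).
exists mu; split; first exact: ord_small.
have /choice[g gP] i : exists x, forall y, ole (h y) (f i) -> ole y x.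
  have /existsNP[x nx] : ~ forall x, exists2 y, olt x y & ole (h y) (f i).
    by move=> bi; apply: nb; exists i.
  by exists x => y yi; rewrite oleNgt; apply/negP => xy; apply: nx; exists y.
exists g => x; have [y xy] := lim x; have [i yi] := fcof (h y).
exists i; apply: olt_le_trans xy _; exact: gP.
Qed.

End Small.

(** * The hierarchy *)

Lemma Sigma0_iso g (T : topologicalType) (a b : ord) (A : set T) :
  (a =~ b)%ord -> Sigma0 g a A -> Sigma0 g b A.
Proof.
move=> ab aA; case: a A / aA ab => [a A a1 Ao|a d c B a1 dg cP cB] ab.
  exact: Sigma0_open (ord_iso_trans (ord_iso_sym ab) a1) Ao.
have ab' := ord_iso_le ab; apply: Sigma0_bigcup dg _ cB; first exact: ord_lt_le_trans ab'.
by move=> i; have [? ca] := cP i; split=> //; exact: ord_lt_le_trans ab'.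
Qed.

Lemma Sigma0_inv g (T : topologicalType) (a : ord) (A : set T) : Sigma0 g a A ->
  ((a =~ ofin 1)%ord /\ open A) \/
  exists (d : ord) (b : d -> ord) (B : d -> set T),
    [/\ (ofin 1 < a)%ord, (d < g)%ord,
        forall i, (ofin 1 <= b i)%ord /\ (b i < a)%ord,
        forall i, Sigma0 g (b i) (B i) & A = \bigcup_i ~` B i].
Proof.
by move=> aA; case: a A / aA => [a A a1 Ao|a d b B a1 dg bP bB]; [left|right; exists d, b, B].
Qed.

Lemma Sigma0_1P g (T : topologicalType) (a : ord) (A : set T) : (a =~ ofin 1)%ord ->
  Sigma0 g a A <-> open A.
Proof.
move=> a1; split=> [/Sigma0_inv[[]//|[d [b [B [a1' _ _ _ _]]]]]|]; last exact: Sigma0_open.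
by case: (@ord_lt_irr (ofin 1)); apply: ord_lt_le_trans a1' (ord_iso_le a1).
Qed.

Lemma Sigma0_preimage g (T T' : topologicalType) (f : T -> T') a (A : set T') :
  continuous f -> Sigma0 g a A -> Sigma0 g a (f @^-1` A).
Proof.
move=> /continuousP fc; elim=> {a A} [a A a1 Ao|a d b B a1 dg bP _ IH].
  by apply: Sigma0_open => //; exact: fc.
rewrite preimage_bigcup; under eq_bigcupr do rewrite preimage_setC.
exact: Sigma0_bigcup bP IH.
Qed.

Lemma bPiP g a (T : topologicalType) (A : set T) : bPi g a T A <-> Sigma0 g a (~` A).
Proof.
split=> [[B BS <-]|AS]; first by rewrite setCK.
by exists (~` A); rewrite ?setCK.
Qed.

Section Levels.
Variables kappa mu : ord.
Hypothesis kappa_card : is_cardinal kappa.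
Hypothesis kappa_unc : ~ countable [set: kappa].
Hypothesis mu_cof : is_cofinality kappa mu.
Hypothesis kappa_sing : (mu < kappa)%ord.
Hypothesis pow_kappa : [set: bseq_lt kappa] #= [set: kappa].

Local Notation Sg := (Sigma0 kappa).
Local Notation small := (small kappa).

Let kappa_inf : infinite_set [set: kappa].
Proof. by move/finite_set_countable. Qed.

Lemma unit_small : small unit.
Proof.
case: (small_or_ge kappa unit) => // ku; case: kappa_inf.
by apply: card_le_finite ku _; exact: finite_finset.
Qed.

Section Space.
Variable T : topologicalType.
Implicit Types A : set T.

(** The index types of unions are only required to be small; the ordinal [d < kappa]
    in the definition of the hierarchy is then a segment of [kappa] in which the
    type embeds. *)
Lemma Sigma0_small_bigcup (S : Type) (a : ord) (b : S -> ord) (B : S -> set T) :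
  small S -> (ofin 1 < a)%ord -> (forall s, (ofin 1 <= b s)%ord /\ (b s < a)%ord) ->
  (forall s, Sg (b s) (B s)) -> Sg a (\bigcup_s ~` B s).
Proof.
move=> [x /card_leTP[h hinj]] a1 bP bB.
have /choice[F FP] (y : oseg x) : exists c : ord * set T,
    [/\ (ofin 1 <= c.1)%ord, (c.1 < a)%ord, Sg c.1 c.2,
        forall s, h s = y -> c.2 = B s & ((exists s, h s = y) \/ c.2 = setT)].
  have [[s sy]|ns] := pselect (exists s, h s = y).
    exists (b s, B s); split=> /=; [exact: (bP s).1|exact: (bP s).2|exact: bB| |].
    - by move=> t ty; congr B; apply: hinj; rewrite sy.
    - by left; exists s.
  (* indices outside the range of [h] contribute the complement of the whole space *)
  exists (ofin 1, setT); split=> //=; first exact: ord_le_refl.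
  - by apply/Sigma0_1P; [exact: ord_iso_refl|exact: openT].
  - by move=> s sy; case: ns; exists s.
  - by right.
have -> : \bigcup_s ~` B s = \bigcup_y ~` (F y).2.
  apply/seteqP; split=> t [s _ st].
    by exists (h s) => //; have [_ _ _ /(_ s erefl) -> _] := FP (h s).
  have [_ _ _ FB [[u us]|E]] := FP s; last by rewrite E setCT in st.
  by exists u => //; rewrite -(FB u us).
apply: (Sigma0_bigcup (b := fun y => (F y).1)) => //.
- exact: oseg_lt.
- by move=> y; have [] := FP y.
- by move=> y; have [] := FP y.
Qed.

Lemma Sigma0_small_inv a A : Sg a A ->
  ((a =~ ofin 1)%ord /\ open A) \/
  exists (S : Type) (b : S -> ord) (B : S -> set T),
    [/\ (ofin 1 < a)%ord, small S,
        forall i, (ofin 1 <= b i)%ord /\ (b i < a)%ord,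
        forall i, Sg (b i) (B i) & A = \bigcup_i ~` B i].
Proof.
case/Sigma0_inv => [|[d [b [B [a1 dg bP bB AB]]]]]; [by left | right].
exists d, b, B; split=> //; exact: ord_small.
Qed.

Lemma Sigma0C a b A : (ofin 1 <= b)%ord -> (b < a)%ord -> Sg b A -> Sg a (~` A).
Proof.
move=> b1 ba bA; have -> : ~` A = \bigcup_(_ : unit) ~` A.
  by apply/seteqP; split=> [x|x []//]; exists tt.
apply: (Sigma0_small_bigcup (b := fun=> b)) => //; first exact: unit_small.
exact: ord_le_lt_trans ba.
Qed.

Lemma Sigma0T a : (ofin 1 <= a)%ord -> Sg a [set: T].
Proof.
case/ord_le_eqVlt => [a1|a1].
  by apply/Sigma0_1P; [exact: ord_iso_sym|exact: openT].
rewrite -setC0; apply: (Sigma0C (ord_le_refl _) a1).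
by apply/Sigma0_1P; [exact: ord_iso_refl|exact: open0].
Qed.

Lemma Sigma0_0 a : (ofin 1 <= a)%ord -> Sg a (@set0 T).
Proof.
case/ord_le_eqVlt => [a1|a1].
  by apply/Sigma0_1P; [exact: ord_iso_sym|exact: open0].
by rewrite -setCT; apply: (Sigma0C (ord_le_refl _) a1); apply: Sigma0T (ord_le_refl _).
Qed.

Definition kunion (Q : set T -> Prop) A :=
  exists2 F : kappa -> set T, (forall x, Q (F x)) & A = \bigcup_x F x.

(** The empty set fills the indices outside the range of an injection in [kappa]. *)
Lemma kunion_bigcup (Q : set T -> Prop) (S : Type) (F : S -> set T) : Q set0 ->
  [set: S] #<= [set: kappa] -> (forall s, Q (F s)) -> kunion Q (\bigcup_s F s).
Proof.
move=> Q0 /card_leTP[h hinj] QF.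
exists (fun x => \bigcup_(s in [set s | h s = x]) F s).
  move=> x; have [[s sx]|ns] := pselect (exists s, h s = x).
    rewrite (_ : bigcup _ _ = F s) //; apply/seteqP; split=> [t [u /= ux]|t st].
      by rewrite (hinj u s) // ux.
    by exists s.
  rewrite (_ : bigcup _ _ = set0) // -subset0 => t [s /= sx].
  by case: ns; exists s.
apply/seteqP; split=> [t [s _ st]|t [x _ [s _ st]]]; last by exists s.
by exists (h s) => //; exists s.
Qed.

Lemma kunion_kunion (Q : set T -> Prop) (S : Type) (A : S -> set T) : Q set0 ->
  [set: S] #<= [set: kappa] -> (forall s, kunion Q (A s)) -> kunion Q (\bigcup_s A s).
Proof.
move=> Q0 Sk QA; have /choice[F FP] s :
    exists F : kappa -> set T, (forall x, Q (F x)) /\ A s = \bigcup_x F x.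
  by have [F] := QA s; exists F.
have -> : \bigcup_s A s = \bigcup_(u : S * kappa) F u.1 u.2.
  apply/seteqP; split=> [t [s _]|t [[s x] _ /= stx]].
    by rewrite (FP s).2 => -[x _ stx]; exists (s, x).
  by exists s => //; rewrite (FP s).2; exists x.
apply: kunion_bigcup => // [|[s x]]; last exact: (FP s).1.
apply: card_le_trans (card_square kappa_inf).
exact: card_le_prod Sk (card_lexx _).
Qed.

(** The bound [N] is uniform, as it becomes the base of the power that counts the
    terms when an intersection is distributed over such unions. *)
Definition small_Fsigma := exists N : Type, small N /\
  forall O : set T, open O ->
  exists2 F : N -> set T, forall n, closed (F n) & O = \bigcup_n F n.

(** The two properties of the open sets from which the next two levels are
    computed. *)
Record open_like (a : ord) : Prop := OpenLike {
  open_like_bigcup : forall (S : Type) (F : S -> set T),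
    [set: S] #<= [set: kappa] -> (forall s, Sg a (F s)) -> Sg a (\bigcup_s F s) ;
  open_like_Fsigma : exists N : Type, small N /\
    forall A, Sg a A ->
    exists2 F : N -> set T, forall n, Sg a (~` F n) & A = \bigcup_n F n }.

Hypothesis TF : small_Fsigma.

Lemma Sigma0_le a b A : (ofin 1 <= b)%ord -> (b <= a)%ord -> Sg b A -> Sg a A.
Proof.
move=> b1 /ord_le_eqVlt[ba|ba]; first exact: Sigma0_iso.
have a1 := ord_le_lt_trans b1 ba.
case/Sigma0_small_inv => [[b1' Ao]|[S [c [B [_ sS cP cB ->]]]]].
  have [N [sN FN]] := TF; have [F Fc ->] := FN _ Ao.
  rewrite (_ : bigcup _ _ = \bigcup_n ~` (~` F n)).
    apply: (Sigma0_small_bigcup (b := fun=> ofin 1)) => // n.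
      by split=> //; exact: ord_le_refl.
    by apply/Sigma0_1P; [exact: ord_iso_refl|exact: closed_openC].
  by under [RHS]eq_bigcupr do rewrite setCK.
apply: Sigma0_small_bigcup cB => // s; have [c1 cb] := cP s; split=> //.
exact: ord_lt_trans ba.
Qed.

(** Every set of level [a] is a union of [N] many complements, so the complement of
    a small union is an intersection over [S] of unions over [N]. Distributing gives
    a union over the functions from [S] to [N], of which there are fewer than
    [kappa], and each term is a complement because level [a] is closed under unions
    of [kappa] many sets. *)
Lemma odd_level_compl a A : (ofin 1 <= a)%ord -> open_like a ->
  Sg (osucc a) A -> Sg (osucc a) (~` A).
Proof.
move=> a1 [aU [N [sN aN]]].
have sa1 : (ofin 1 < osucc a)%ord by apply/ord_lt_succP.
case/Sigma0_small_inv => [[a1' _]|[S [b [B [_ sS bP bB ->]]]]].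
  by case: (@ord_lt_irr (ofin 1)); exact: ord_lt_le_trans sa1 (ord_iso_le a1').
have /choice[F FP] s : exists F : N -> set T,
    (forall n, Sg a (~` F n)) /\ B s = \bigcup_n F n.
  have [b1 /ord_lt_succP ba] := bP s.
  by have [F ? ?] := aN _ (Sigma0_le b1 ba (bB s)); exists F.
have -> : ~` (\bigcup_s ~` B s) = \bigcup_(h : S -> N) ~` (\bigcup_s ~` F s (h s)).
  apply/seteqP; split=> [t nt|t [h _ ht] [s _ st]].
    have /choice[h hP] s : exists n, F s n t.
      apply: contrapT => nF; apply: nt; exists s => //; rewrite (FP s).2 => -[n _ sn].
      by apply: nF; exists n.
    by exists h => // -[s _]; apply; exact: hP.
  apply: ht; exists s => //= sht; apply: st; rewrite (FP s).2.
  by exists (h s).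
apply: (Sigma0_small_bigcup (b := fun=> a)) => //.
- exact: small_exp kappa_card kappa_unc mu_cof kappa_sing pow_kappa _ _ sS sN.
- by split=> //; exact: ord_lt_succ.
- move=> h; apply: aU => [|s]; last exact: (FP s).1.
  exact: small_le_kappa.
Qed.

Let osucc2_gt1 a : (ofin 1 < osucc (osucc a))%ord.
Proof.
apply/ord_lt_succP; exact: (@ofin1_le (osucc _) (inr ord0)).
Qed.

(** The index set [kappa] is the union of [mu] many proper segments, and each of
    them gives a small union. *)
Lemma kunion_regroup a : (ofin 1 <= a)%ord -> open_like a ->
  exists N : Type, small N /\
    forall A, kunion (fun B => Sg a (~` B)) A -> exists2 F : N -> set T,
      forall n, Sg (osucc a) (F n) & A = \bigcup_n F n.
Proof.
move=> a1 aO; have [[f fcof] _] := mu_cof.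
exists mu; split; first exact: ord_small.
move=> A [F Fa ->].
exists (fun i => \bigcup_(s : {x | ole x (f i)}) ~` ~` F (val s)) => [i|].
  apply: (Sigma0_small_bigcup (b := fun=> a)) => //.
  - have [z fz] := kappa_nomax kappa_card kappa_unc (f i).
    apply: (small_inj (f := fun y : {x | ole x (f i)} =>
      exist (fun x => olt x z) (val y) (ole_lt_trans (valP y) fz))); last exact: seg_small.
    by move=> y y' [] /val_inj.
  - by apply/ord_lt_succP.
  - by split=> //; exact: ord_lt_succ.
apply/seteqP; split=> [t [x _ xt]|t [i _ [[x xi] _]]]; last first.
  by rewrite setCK; exists x.
by have [i xi] := fcof x; exists i => //; exists (exist _ x xi) => //=; rewrite setCK.
Qed.

(** The intermediate level is closed under complements. Hence the terms of a union
    at level [a + 2] are small unions of complements of sets of level [a], and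
    conversely the small unions found by [kunion_regroup] are complements of sets
    of level [a + 1]. *)
Lemma Sigma0_succ2P a A : (ofin 1 <= a)%ord -> open_like a ->
  Sg (osucc (osucc a)) A <-> kunion (fun B => Sg a (~` B)) A.
Proof.
move=> a1 aO; have Q0 : Sg a (~` (@set0 T)) by rewrite setC0; exact: Sigma0T.
have sa1 : (ofin 1 <= osucc a)%ord by apply: ord_le_trans a1 _; left; exact: ord_lt_succ.
have sa1' : (ofin 1 < osucc a)%ord by apply/ord_lt_succP.
split=> [|AU]; last first.
  have [N [sN /(_ A AU)[F FP ->]]] := kunion_regroup a1 aO.
  rewrite (_ : bigcup _ _ = \bigcup_n ~` ~` F n); last first.
    by under [RHS]eq_bigcupr do rewrite setCK.
  apply: (Sigma0_small_bigcup (b := fun=> osucc a)) => // n.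
    by split=> //; exact: ord_lt_succ.
  exact: odd_level_compl.
case/Sigma0_small_inv => [[a1' _]|[S [b [B [_ sS bP bB ->]]]]].
  by case: (@ord_lt_irr (ofin 1)); exact: ord_lt_le_trans (osucc2_gt1 a) (ord_iso_le a1').
apply: kunion_kunion => // [|s]; first exact: small_le_kappa.
have [b1 /ord_lt_succP ba] := bP s.
have /(odd_level_compl a1 aO) := Sigma0_le b1 ba (bB s).
case/Sigma0_small_inv => [[a1' _]|[S' [b' [B' [_ sS' bP' bB' ->]]]]].
  by case: (@ord_lt_irr (ofin 1)); exact: ord_lt_le_trans sa1' (ord_iso_le a1').
apply: kunion_bigcup => // [|s']; first exact: small_le_kappa.
have [b1' /ord_lt_succP ba'] := bP' s'; rewrite setCK.
exact: Sigma0_le (bB' s').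
Qed.

Lemma open_like_succ2 a : (ofin 1 <= a)%ord -> open_like a ->
  open_like (osucc (osucc a)).
Proof.
move=> a1 aO; have Q0 : Sg a (~` (@set0 T)) by rewrite setC0; exact: Sigma0T.
have sa1 : (ofin 1 <= osucc a)%ord by apply: ord_le_trans a1 _; left; exact: ord_lt_succ.
split=> [S F Sk FS|].
  apply/Sigma0_succ2P => //; apply: kunion_kunion => // s.
  exact/Sigma0_succ2P.
have [N [sN NP]] := kunion_regroup a1 aO; exists N; split=> // A.
move=> /(Sigma0_succ2P _ a1 aO)/NP[F FP ->]; exists F => // n.
apply: (Sigma0C sa1) (FP n); exact: ord_lt_succ.
Qed.

(** At a limit the index set [kappa] is divided by a pair of bounds, one on the index
    in [kappa] and one on the level in [l]; the second runs over a small cofinal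
    family as well, since [l] has size at most the singular cardinal [kappa]. *)
Lemma open_like_limit (l : ord) : is_limit l -> [set: l] #<= [set: kappa] ->
  open_like l.
Proof.
move=> ll lk; have [[f fcof] _] := mu_cof.
have [N [sN [g gcof]]] := small_cofinal kappa_card kappa_unc mu_cof kappa_sing lk ll.
pose Q A := exists b, [/\ (ofin 1 <= b)%ord, (b < l)%ord & Sg b (~` A)].
have l1 : (ofin 1 < l)%ord.
  have [[x _] lim] := ll; have [y xy] := lim x; apply: ord_le_lt_trans (oseg_lt y).
  exact: (@ofin1_le (oseg y) (exist _ x xy)).
have Q0 : Q set0.
  exists (ofin 1); split=> //; first exact: ord_le_refl.
  by rewrite setC0; apply: Sigma0T (ord_le_refl _).
(* one step above the levels of the terms suffices unless [g n] is the bottom of [l];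
     two steps always exceed level 1 *)
pose lev n := osucc (osucc (oseg (g n))).
have levl n : (lev n < l)%ord.
  by apply: is_limit_succ => //; apply: is_limit_succ => //; exact: oseg_lt.
have regroup A : kunion Q A -> exists2 F : mu * N -> set T,
    forall u, Sg (lev u.2) (F u) & A = \bigcup_u F u.
  move=> [F /choice[b bP] ->].
  pose I u := {x | `[< ole x (f u.1) /\ (b x <= oseg (g u.2))%ord >]}.
  exists (fun u => \bigcup_(s : I u) ~` ~` F (val s)) => [u|].
    apply: (Sigma0_small_bigcup (b := fun s => b (val s))).
    - have [z fz] := kappa_nomax kappa_card kappa_unc (f u.1).
      have Iz (y : I u) : olt (val y) z.
        by have /asboolP[yf _] := valP y; exact: ole_lt_trans yf fz.
      apply: (small_inj (f := fun y : I u => exist (fun x => olt x z) (val y) (Iz y))).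
        by move=> y y' [] /val_inj.
      exact: seg_small.
    - exact: osucc2_gt1.
    - move=> y; have [b1 _ _] := bP (val y); split=> //.
      have /asboolP[_ yg] := valP y; apply: ord_le_lt_trans yg _.
      by apply: ord_lt_trans (ord_lt_succ _) (ord_lt_succ _).
    - by move=> y; have [] := bP (val y).
  apply/seteqP; split=> [t [x _ xt]|t [u _ [[x xi] _]]]; last first.
    by rewrite setCK; exists x.
  have [_ /ord_lt_seg[z bz] _] := bP x; have [n zn] := gcof z.
  have [i xi] := fcof x; have Ix : `[< ole x (f i) /\ (b x <= oseg (g n))%ord >].
    apply/asboolP; split=> //; apply: ord_le_trans (ord_iso_le bz) _.
    by apply: oseg_mono; exact: oltW.
  by exists (i, n) => //; exists (exist _ x Ix) => //=; rewrite setCK.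
have lev1 n : (ofin 1 <= lev n)%ord by left; exact: osucc2_gt1.
have SgU A : Sg l A -> kunion Q A.
  case/Sigma0_small_inv => [[l1' _]|[S [b [B [_ sS bP bB ->]]]]].
    by case: (@ord_lt_irr (ofin 1)); exact: ord_lt_le_trans l1 (ord_iso_le l1').
  apply: kunion_bigcup => // [|s]; first exact: small_le_kappa.
  by have [b1 bl] := bP s; exists (b s); rewrite setCK.
split=> [S F Sk FS|].
  have /regroup[G GP ->] : kunion Q (\bigcup_s F s).
    by apply: kunion_kunion => // s; exact: SgU.
  rewrite (_ : bigcup _ _ = \bigcup_n ~` ~` G n); last first.
    by under [RHS]eq_bigcupr do rewrite setCK.
  apply: (Sigma0_small_bigcup (b := fun u => osucc (lev u.2))) => // [|u|u].
  - by apply: (small_prod kappa_card kappa_unc mu_cof kappa_sing) => //; exact: ord_small.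
  - by split; [left; exact: osucc2_gt1|exact: is_limit_succ].
  - exact: Sigma0C (lev1 _) (ord_lt_succ _) (GP u).
exists (mu * N)%type; split.
  by apply: (small_prod kappa_card kappa_unc mu_cof kappa_sing) => //; exact: ord_small.
move=> A /SgU/regroup[G GP ->]; exists G => // u.
exact: Sigma0C (lev1 _) (levl _) (GP u).
Qed.

Lemma even_level_open_like a : even_level a -> [set: a] #<= [set: kappa] -> open_like a.
Proof.
elim=> {a} [a a1 _|a|a b bE IH ab ak]; last first.
- have ba : (b < a)%ord.
    apply: ord_lt_le_trans (ord_iso_ge ab); exact: ord_lt_trans (ord_lt_succ _) (ord_lt_succ _).
  have bO : open_like b.
    by apply: IH; apply: card_le_trans ak; exact: ord_le_card (ord_ltW ba).
  have [cU [N [sN cN]]] := open_like_succ2 (level_ge1 bE) bO.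
  split=> [S F Sk FS|].
    apply: (Sigma0_iso (ord_iso_sym ab)); apply: cU => // s; exact: Sigma0_iso ab _.
  exists N; split=> // A /(Sigma0_iso ab)/cN[F FP ->]; exists F => // n.
  exact: Sigma0_iso (ord_iso_sym ab) _.
- exact: open_like_limit.
split=> [S F _ FS|].
  apply/Sigma0_1P => //; apply: bigcup_open => s _; exact/(Sigma0_1P _ _ a1).
have [N [sN NP]] := TF; exists N; split=> // A /(Sigma0_1P _ _ a1)/NP[F Fc ->].
by exists F => // n; apply/Sigma0_1P => //; exact: closed_openC.
Qed.

End Space.
End Levels.

(** * The generalized Cantor space *)

Lemma continuous_pair (T U V : topologicalType) (f : T -> U) (g : T -> V) :
  continuous f -> continuous g -> continuous (fun x => (f x, g x)).
Proof. by move=> fc gc x; apply: cvg_pair; [exact: fc|exact: gc]. Qed.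

Lemma continuous_fst (T U : topologicalType) : continuous (fst : T * U -> T).
Proof. by move=> p; exact: cvg_fst. Qed.

Lemma continuous_snd (T U : topologicalType) : continuous (snd : T * U -> U).
Proof. by move=> p; exact: cvg_snd. Qed.

Section Cantor.
Variables kappa mu : ord.
Hypothesis kappa_card : is_cardinal kappa.
Hypothesis kappa_unc : ~ countable [set: kappa].
Hypothesis mu_cof : is_cofinality kappa mu.
Hypothesis kappa_sing : (mu < kappa)%ord.
Hypothesis pow_kappa : [set: bseq_lt kappa] #= [set: kappa].

Local Notation C := (cantor kappa).
Local Notation small := (small kappa).

Definition agree (y : C) (x : kappa) : set C := [set z | forall u, olt u x -> z u = y u].

Lemma agree_refl y x : agree y x y.
Proof. by []. Qed.

Lemma agree_sub y x x' : ole x x' -> agree y x' `<=` agree y x.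
Proof. by move=> xx' z yz u ux; apply: yz; exact: olt_le_trans xx'. Qed.

Lemma agree_eq y z x : agree y x z -> agree z x = agree y x.
Proof.
by move=> yz; apply/seteqP; split=> w wP u ux; rewrite wP ?yz.
Qed.

Lemma agree_cylinder y x :
  agree y x = cylinder (existT (fun x => {u | olt u x} -> bool) x (fun u => y (val u))).
Proof.
apply/seteqP; split=> z yz; first by move=> u; exact: yz (valP u).
by move=> u ux; exact: yz (exist _ u ux).
Qed.

Lemma cantor_nbhsP (y : C) (B : set C) :
  nbhs y B <-> exists x, agree y x `<=` B.
Proof.
have [x0 _] : [set: kappa] !=set0.
  by apply: infinite_setN0 => /finite_set_countable.
have FF : Filter [set B | exists x, agree y x `<=` B].
  split; first by exists x0.
    move=> P Q [x xP] [x' xQ]; exists (omax x x') => z yz; split.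
      by apply: xP; apply: agree_sub yz; exact: omaxl.
    by apply: xQ; apply: agree_sub yz; exact: omaxr.
  by move=> P Q PQ [x xP]; exists x => z /xP/PQ.
split=> [|[x xB]]; rewrite nbhsE.
  move=> [_ [[D sD <-] [E DE Ey]] sUB].
  apply: (@filterS _ _ FF E); first by move=> z Ez; apply: sUB; exists E.
  have /sD [S SD SE] := DE; rewrite -SE; apply: filter_bigI => A AS.
  have /set_mem[s _ sA] := SD _ AS.
  have : (A : set C) y by move: Ey; rewrite -SE; apply.
  rewrite -sA; case: s {sA} => x s ys; exists x => z yz u.
  by rewrite yz ?(valP u) // -(ys u).
exists (agree y x) => //; split; last exact: agree_refl.
exists [set agree y x]; last by rewrite bigcup_set1.
move=> _ ->; exists [fset (agree y x)]%fset.
  by move=> A /fset1P ->; apply/mem_set; rewrite agree_cylinder; eexists.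
apply/seteqP; split=> [z|z yz A /fset1P -> //].
by move=> /(_ (agree y x)); apply; exact/fset1P.
Qed.

Lemma cantor_continuous (f : C -> C) :
  (forall x, exists x', forall y z, agree y x' z -> agree (f y) x (f z)) -> continuous f.
Proof.
move=> fP y B /cantor_nbhsP[x xB]; apply/cantor_nbhsP.
by have [x' x'P] := fP x; exists x' => z /x'P/xB.
Qed.

(** For [f] cofinal, an open set [W] is the union over [i] of rectangles
    [agree y (f i) `*` V y i] with [V y i] open. For each [i] their first sides form
    a partition of [C] in clopen sets, so the closed pieces of the sets [V y i] with
    the same index add up to a closed set. *)
Lemma small_Fsigma_prod (X : topologicalType) :
  small_Fsigma kappa X -> small_Fsigma kappa (C * X)%type.
Proof.
move=> [N [sN NP]]; have [[f fcof] _] := mu_cof.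
exists (mu * N)%type; split.
  by apply: (small_prod kappa_card kappa_unc mu_cof kappa_sing) => //; exact: ord_small.
have /choice[cl clP] (O : set X) : exists F : N -> set X,
    open O -> (forall n, closed (F n)) /\ O = \bigcup_n F n.
  have [/NP[F Fc OF]|nO] := pselect (open O); first by exists F.
  by exists (fun=> set0).
move=> W Wo.
pose V (y : C) i : set X := \bigcup_(U in [set U | open U /\ agree y (f i) `*` U `<=` W]) U.
have Vo y i : open (V y i) by apply: bigcup_open => U [].
exists (fun u => [set p : C * X | cl (V p.1 u.1) u.2 p.2]) => [[i n]|].
  rewrite -openC openE => -[y x] /= nx; rewrite /interior /=.
  exists (agree y (f i), ~` cl (V y i) n) => /=.
    split; first by apply/cantor_nbhsP; exists (f i).
    apply: open_nbhs_nbhs; split=> //; apply: closed_openC.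
    exact: (clP _ (Vo y i)).1.
  move=> [z t] [/= yz nt]; rewrite (_ : V z i = V y i) //.
  by rewrite /V (agree_eq yz).
apply/seteqP; split=> [[y x] yxW|[y x] [[i n] _ /= yx]].
  have /(_ _ yxW) : W `<=` nbhs^~ W by move: Wo; rewrite openE.
  move=> [[P Q] /= [/cantor_nbhsP[z zP]]]; rewrite nbhsE => -[U [Uo Ux] UQ] PQW.
  have [i zi] := fcof z.
  have : V y i x.
    exists U => //; split=> // -[w t] [/= yw Ut]; apply: PQW; split=> /=.
      by apply: zP; apply: agree_sub yw.
    exact: UQ.
  by rewrite (clP _ (Vo y i)).2 => -[n _ xn]; exists (i, n).
have : V y i x by rewrite (clP _ (Vo y i)).2; exists n.
by move=> [U [_ UW] Ux]; apply: UW; split.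
Qed.

Lemma small_Fsigma_preimage (T T' : topologicalType) (f : T -> T') :
  continuous f -> (forall O : set T, open O -> exists2 O', open O' & O = f @^-1` O') ->
  small_Fsigma kappa T' -> small_Fsigma kappa T.
Proof.
move=> fc fO [N [sN NP]]; exists N; split=> // O /fO[O' /NP[F Fc ->] ->].
exists (fun n => f @^-1` F n); last by rewrite preimage_bigcup.
by move=> n; apply: closed_comp (Fc n) => x _; exact: fc.
Qed.

(** [C] is a slice of the product with a nonempty space. *)
Lemma small_Fsigma_cantor (X : topologicalType) : [set: X] !=set0 ->
  small_Fsigma kappa X -> small_Fsigma kappa C.
Proof.
move=> [x0 _] /small_Fsigma_prod.
apply: (@small_Fsigma_preimage _ _ (fun y => (y, x0))).
  by apply: continuous_pair => [y|y]; [exact: cvg_id|exact: cst_continuous].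
move=> O Oo; exists (fst @^-1` O) => //.
by move/continuousP: (@continuous_fst C X); apply.
Qed.

Lemma cantor_weight : weight_le C kappa.
Proof.
exists (range (@cylinder kappa)); last first.
  apply: card_le_trans (card_image_le _ _) _.
  by have /card_eqPle[] := pow_kappa.
split=> [_ [[x s] _ <-]|y B /cantor_nbhsP[x xB]].
  rewrite openE => y ys; apply/cantor_nbhsP; exists x => z yz u.
  by rewrite yz ?(valP u) // -(ys u).
exists (agree y x) => //; split; last exact: agree_refl.
by rewrite agree_cylinder; eexists.
Qed.

End Cantor.

(** * Universal sets *)

Section Universal.
Variables kappa mu : ord.
Hypothesis kappa_card : is_cardinal kappa.
Hypothesis kappa_unc : ~ countable [set: kappa].
Hypothesis mu_cof : is_cofinality kappa mu.
Hypothesis kappa_sing : (mu < kappa)%ord.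
Hypothesis pow_kappa : [set: bseq_lt kappa] #= [set: kappa].

Local Notation C := (cantor kappa).
Local Notation Sg := (Sigma0 kappa).

(** The coordinates of a sequence under the pairing function. Any [kappa] of them
    can be prescribed, which assembles universal sets from those of lower levels;
    and one coordinate can be set continuously while another is fixed, which makes
    a universal set for [C] complete. *)
Lemma coding : exists dec : kappa -> C -> C,
  [/\ forall x, continuous (dec x),
      forall (S : Type) (h : S -> kappa) (Y : S -> C), injective h ->
        exists y, forall s, dec (h s) y = Y s &
      forall x x', x <> x' -> forall y, exists2 enc : C -> C, continuous enc &
        forall z, dec x (enc z) = y /\ dec x' (enc z) = z].
Proof.
have [p [pinj pmono]] := pairing kappa_card kappa_unc.
exists (fun x y z => y (p x z)); split.
- move=> x; apply: cantor_continuous => // v; exists (p x v) => y z yz u uv.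
  by apply: yz; rewrite (mono_olt (pmono x)).
- move=> S h Y hinj; exists (fun z => `[< exists s t, p (h s) t = z /\ Y s t >]).
  move=> s; apply/funext => t; apply/asboolP/idP => [[s' [t' [/pinj[/hinj -> ->]]]]//|].
  by move=> st; exists s, t.
- move=> x x' xx' y.
  exists (fun z w => `[< (exists2 t, p x t = w & y t) \/ (exists2 t, p x' t = w & z t) >]).
    (* the value at [w = p x' t] only depends on [t], which is at most [w] *)
    apply: cantor_continuous => // v; exists v => z z' zz' u uv /=.
    congr asbool; apply/propext; split=> -[?|[t tu zt]]; [by left| |by left|];
      right; exists t => //; move: zt; rewrite zz' //; apply: ole_lt_trans uv;
      rewrite -tu; exact: init_emb_ge.
  move=> z; split; apply/funext => t; apply/asboolP/idP => [[][s]|].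
  + by move=> /pinj[_ ->].
  + by move=> /pinj[/esym].
  + by left; exists t.
  + by move=> /pinj[].
  + by move=> /pinj[_ ->].
  + by right; exists t.
Qed.

Definition section_universal (a : ord) (Y X : topologicalType) :=
  exists2 U : set (Y * X), Sg a U &
    forall A : set X, Sg a A -> exists y, A = [set x | U (y, x)].

Lemma section_universalP a (Y X : topologicalType) :
  section_universal a Y X -> has_universal (bSigma kappa a) Y X.
Proof.
move=> [U US UP]; exists U; split=> //; apply/seteqP; split=> [A /UP[y ->]|_ [y _ <-]].
  by exists y => //; apply/seteqP; split=> x; rewrite /xsection /= inE.
rewrite (_ : xsection U y = (fun x => (y, x)) @^-1` U); last first.
  by apply/seteqP; split=> x; rewrite /xsection /= inE.
apply: Sigma0_preimage US; apply: continuous_pair => x; last exact: cvg_id.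
exact: cst_continuous.
Qed.

Section Space.
Variable X : topologicalType.
Hypothesis X_weight : weight_le X kappa.
Hypothesis X_Fsigma : small_Fsigma kappa X.

Let CX_Fsigma : small_Fsigma kappa (C * X)%type.
Proof. exact: small_Fsigma_prod mu_cof kappa_sing _ X_Fsigma. Qed.

(** The sequence [y] lists the sets of a base that are put into the union. *)
Lemma universal_open : section_universal (ofin 1) C X.
Proof.
have [B [Bo Bx]] := X_weight; rewrite -(card_le_eql (card_setT B)) => /card_leTP[h hinj].
exists (\bigcup_V [set p : C * X | p.1 (h V) /\ set_val V p.2]).
  apply/Sigma0_1P; first exact: ord_iso_refl.
  apply: bigcup_open => V _; rewrite openE => -[y x] /= [yV Vx].
  have [z hz] := kappa_nomax kappa_card kappa_unc (h V).
  exists (agree y z, set_val V) => /=.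
    split; first by apply/cantor_nbhsP => //; exists z.
    apply: open_nbhs_nbhs; split=> //; apply: Bo; exact: set_valP.
  by move=> [y' x'] /= [yy' Vx']; split=> //; rewrite yy'.
move=> A /(Sigma0_1P _ _ (ord_iso_refl _)) Ao.
exists (fun x => `[< exists2 V, h V = x & set_val V `<=` A >]).
apply/seteqP; split=> [x Ax|x [V _ /= [/asboolP[V' /hinj -> VA]]]]; last exact: VA.
have [V [BV Vx] VA] := Bx x A (open_nbhs_nbhs (conj Ao Ax)).
exists (SigSub (mem_set BV)) => //=; split=> //; apply/asboolP.
by exists (SigSub (mem_set BV)).
Qed.

(** At a successor step the coordinates of [y] are codes for the [kappa] many sets
    given by [Sigma0_succ2P]. At a limit [l], a set is the union over [z] in [l] of its
    part of level less than [c], for an even level [c < l] chosen above [z]; that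
    part has level [c], and the union is of level [l] because it is indexed by at
    most [kappa] elements. *)
Lemma universal_even a : even_level a -> [set: a] #<= [set: kappa] ->
  section_universal a C X.
Proof.
have [dec [decc decs _]] := coding.
have pairc x : continuous (fun u : C * X => (dec x u.1, u.2)).
  apply: continuous_pair; last exact: continuous_snd.
  by move=> u; apply: continuous_comp; [exact: continuous_fst|exact: decc].
elim/ord_lt_ind: a => a IH aE ak.
have aO T : small_Fsigma kappa T -> open_like kappa T a.
  by move=> TF; exact: (even_level_open_like kappa_card kappa_unc mu_cof).
case: a / aE IH ak aO => [a a1 _ _ _|l ll IH lk lO|a b bE ab IH ak _].
- have [U US UP] := universal_open; exists U; first exact: Sigma0_iso (ord_iso_sym a1) US.
  by move=> A /(Sigma0_iso a1)/UP.
- have /card_leTP[h hinj] := lk.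
  have /choice[F FP] (z : l) : exists c : ord * set (C * X),
      [/\ even_level c.1, (oseg z <= c.1)%ord, (c.1 < l)%ord, Sg c.1 c.2 &
          forall A : set X, Sg c.1 A -> exists y, A = [set x | c.2 (y, x)]].
    have [c [cE zc cl]] := even_level_cofinal ll (oseg_lt z).
    have [|U US UP] := IH c cl cE; last by exists (c, U).
    apply: card_le_trans lk; exact: ord_le_card (ord_ltW cl).
  exists (\bigcup_z (fun u => (dec (h z) u.1, u.2)) @^-1` (F z).2).
    apply: (open_like_bigcup (lO _ CX_Fsigma)) => // z.
    have [cE _ cl US _] := FP z; apply: Sigma0_preimage; first exact: pairc.
    apply: (Sigma0_le CX_Fsigma _ _ US); first exact: level_ge1.
    exact: ord_ltW.
  move=> A /Sigma0_small_inv[[l1 _]|[S [b [B [_ sS bP bB ->]]]]].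
    have [[x _] lim] := ll; case: l1 => f [g fK gK] fm.
    by have [y] := lim x; rewrite -(mono_olt fm) (ord1 (f x)) (ord1 (f y)).
  have /choice[Y YP] z : exists y,
      \bigcup_(s in [set s | (b s < (F z).1)%ord]) ~` B s = [set x | (F z).2 (y, x)].
    have [cE _ _ _] := FP z; apply.
    have [[s0 s0z]|ns] := pselect (exists s, (b s < (F z).1)%ord).
      rewrite (_ : bigcup _ _ =
          \bigcup_(s : {s | `[< (b s < (F z).1)%ord >]}) ~` B (val s)).
        apply: (Sigma0_small_bigcup (b := fun s => b (val s))) => [| |s|s] //.
        - exact: (small_inj (f := val) val_inj).
        - exact: ord_le_lt_trans (bP s0).1 s0z.
        - by split; [exact: (bP _).1|apply/asboolP; exact: (valP s)].
      apply/seteqP; split=> [x [s /= sz sx]|x [[s sz] _ sx]].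
        by exists (exist _ s (asboolT sz)).
      by exists s => //; exact/asboolP.
    rewrite (_ : bigcup _ _ = set0); first by apply: Sigma0_0 => //; exact: level_ge1.
    by rewrite -subset0 => x [s sz _]; apply: ns; exists s.
  have [y yP] := decs _ h Y hinj; exists y; apply/seteqP; split=> [x [s _ sx]|].
    have [u bu] := ord_lt_seg (bP s).2; have [v uv] := ll.2 u.
    exists v => //=; rewrite yP.
    suff : [set x | (F v).2 (Y v, x)] x by [].
    rewrite -YP; exists s => //=; have [_ vF _ _ _] := FP v.
    apply: ord_lt_le_trans vF; apply: ord_le_lt_trans (ord_iso_le bu) _.
    exact: oseg_lt_mono.
  move=> x [z _ /=]; rewrite yP => zx.
  have : [set x | (F z).2 (Y z, x)] x by [].
  by rewrite -YP => -[s _ sx]; exists s.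
have b1 := level_ge1 bE.
have ba : (b < a)%ord.
  apply: ord_lt_le_trans (ord_iso_ge ab); exact: ord_lt_trans (ord_lt_succ _) (ord_lt_succ _).
have bk : [set: b] #<= [set: kappa].
  by apply: card_le_trans ak; exact: ord_le_card (ord_ltW ba).
have bO T : small_Fsigma kappa T -> open_like kappa T b.
  by move=> TF; exact: (even_level_open_like kappa_card kappa_unc mu_cof).
have succ2P T (TF : small_Fsigma kappa T) A := Sigma0_succ2P kappa_card kappa_unc
  mu_cof kappa_sing pow_kappa TF A b1 (bO _ TF).
have [U US UP] := IH b ba bE bk.
exists (\bigcup_x ~` ((fun u => (dec x u.1, u.2)) @^-1` U)).
  apply: (Sigma0_iso (ord_iso_sym ab)); apply/(succ2P _ CX_Fsigma).
  exists (fun x => ~` ((fun u => (dec x u.1, u.2)) @^-1` U)) => // x.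
  by rewrite setCK; exact: Sigma0_preimage (pairc x) US.
move=> A /(Sigma0_iso ab)/(succ2P _ X_Fsigma)[F Fb ->].
have /choice[Y YP] x : exists y, ~` F x = [set t | U (y, t)] by exact: UP.
have [y yP] := decs kappa id Y (fun _ _ => id); exists y.
have E x t : F x t <-> ~ U (dec x y, t).
  rewrite yP; have -> : U (Y x, t) = (~` F x) t by rewrite YP.
  by split=> [Fx|/contrapT]; [apply|].
apply/seteqP; split=> [t [x _ /E xt]|t [x _ /= /E xt]]; by exists x.
Qed.

End Space.
End Universal.

(** * Diagonalization, completeness and the theorem *)

(** Cantor's diagonal argument: the complement of the diagonal section of a
    universal set would be one of its sections. *)
Lemma has_universal_diag (G : pointclass) (Y : topologicalType) :
  (forall (f : Y -> Y * Y) U, continuous f -> G (Y * Y)%type U -> G Y (f @^-1` U)) ->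
  (forall A, G Y A -> G Y (~` A)) -> ~ has_universal G Y Y.
Proof.
move=> Gpre GC [U [GU]] /seteqP[sub _].
have [|y _] := sub (~` ((fun y => (y, y)) @^-1` U)).
  by apply: GC; apply: Gpre GU; apply: continuous_pair => x; exact: cvg_id.
move/seteqP => [H1 H2]; have nU : ~ U (y, y).
  by move=> Uy; apply: (H1 y) => //; rewrite /xsection /= inE.
by have := H2 y nU; rewrite /xsection /= inE.
Qed.

Lemma bPi_preimage g a (T T' : topologicalType) (f : T -> T') (A : set T') :
  continuous f -> bPi g a T' A -> bPi g a T (f @^-1` A).
Proof.
move=> fc /bPiP AS; apply/bPiP; rewrite preimage_setC; exact: Sigma0_preimage.
Qed.

Lemma bDelta_preimage g a (T T' : topologicalType) (f : T -> T') (A : set T') :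
  continuous f -> bDelta g a T' A -> bDelta g a T (f @^-1` A).
Proof.
by move=> fc [AS AP]; split; [exact: Sigma0_preimage AS|exact: bPi_preimage AP].
Qed.

Lemma bDeltaC g a (T : topologicalType) (A : set T) : bDelta g a T A -> bDelta g a T (~` A).
Proof. by move=> [AS /bPiP AP]; split=> //; apply/bPiP; rewrite setCK. Qed.

Lemma bBorC g (T : topologicalType) (A : set T) : bBor g T A -> bBor g T (~` A).
Proof. by move=> AB F [[FC FU] Fo]; exact: (FC _ (AB F (conj (conj FC FU) Fo))). Qed.

Lemma bBor_preimage g (T T' : topologicalType) (f : T -> T') (A : set T') :
  continuous f -> bBor g T' A -> bBor g T (f @^-1` A).
Proof.
move=> /continuousP fc AB; apply: (AB [set B | bBor g T (f @^-1` B)]); split.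
  split=> [B|d B dg IH].
    by rewrite /= -preimage_setC; exact: bBorC.
  rewrite /= preimage_bigcup => F [[FC FU] Fo]; apply: (FU _ _ dg) => i.
  exact: (IH i F (conj (conj FC FU) Fo)).
by move=> O Oo F [_ Fo]; apply: Fo; exact: fc.
Qed.

Lemma bDelta_no_universal g a (Y : topologicalType) : ~ has_universal (bDelta g a) Y Y.
Proof.
apply: has_universal_diag => [f U|A]; [exact: bDelta_preimage|exact: bDeltaC].
Qed.

Lemma bBor_no_universal g (Y : topologicalType) : ~ has_universal (bBor g) Y Y.
Proof.
apply: has_universal_diag => [f U|A]; [exact: bBor_preimage|exact: bBorC].
Qed.

Lemma has_universalC g a (Y X : topologicalType) :
  has_universal (bSigma g a) Y X -> has_universal (bPi g a) Y X.
Proof.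
have xC (U : set (Y * X)) y : xsection (~` U) y = ~` xsection U y.
  by apply/seteqP; split=> x; rewrite /xsection /= !inE.
move=> [U [US UE]]; exists (~` U); split; first by exists U.
by rewrite /bPi UE; apply/seteqP; split=> [_ [_ [y _ <-] <-]|_ [y _ <-]];
  [exists y|exists (xsection U y)] => //; exists y.
Qed.

Lemma completeC k g a (X : topologicalType) (A : set X) :
  complete k (bSigma g a) A <-> complete k (bPi g a) (~` A).
Proof.
split=> -[AG AP]; split.
- by exists A.
- move=> _ [B /AP[f fc ->] <-]; exists f => //; by rewrite -preimage_setC.
- by move/bPiP: AG; rewrite setCK.
- move=> B BS; have [|f fc] := AP (~` B); first by exists B.
  by rewrite preimage_setC => /setC_inj; exists f.
Qed.

(** Preimages commute with unions and complements, so the extension of open sets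
    propagates along the hierarchy. *)
Lemma Sigma0_extend g (T T' : topologicalType) (f : T -> T') a (A : set T) :
  (forall O : set T, open O -> exists2 O', open O' & O = f @^-1` O') ->
  Sigma0 g a A -> exists2 A', Sigma0 g a A' & A = f @^-1` A'.
Proof.
move=> fO; elim=> {a A} [a A a1 /fO[O Oo ->]|a d b B a1 dg bP _ IH].
  by exists O => //; exact: Sigma0_open.
have /choice[B' BP] i : exists B', Sigma0 g (b i) B' /\ B i = f @^-1` B'.
  by have [B'] := IH i; exists B'.
exists (\bigcup_i ~` B' i).
  by apply: Sigma0_bigcup bP _ => // i; have [] := BP i.
rewrite preimage_bigcup; apply: eq_bigcupr => i _.
by rewrite -preimage_setC (BP i).2.
Qed.

Lemma embeds_open (Y X : topologicalType) : embeds Y X -> exists e : Y -> X,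
  continuous e /\ forall O : set Y, open O -> exists2 O', open O' & O = e @^-1` O'.
Proof.
move=> [e [einj ec eo]]; exists e; split=> // O /eo[V Vo OV]; exists V => //.
apply/seteqP; split=> [x Ox|x Vx].
  suff [] : (V `&` range e) (e x) by [].
  by rewrite -OV; exists x.
suff : (V `&` range e) (e x) by rewrite -OV => -[z Oz /einj <-].
by split=> //; exists x.
Qed.

Lemma prod_preimage_open (Y Z X : topologicalType) (e : Y -> Z) :
  (forall O : set Y, open O -> exists2 O', open O' & O = e @^-1` O') ->
  forall O : set (Y * X), open O -> exists2 O' : set (Z * X), open O' &
    O = (fun u => (e u.1, u.2)) @^-1` O'.
Proof.
move=> eO O; rewrite openE => Oo.
exists (\bigcup_(W in [set W : set Z * set X |
  [/\ open W.1, open W.2 & (e @^-1` W.1) `*` W.2 `<=` O]]) (W.1 `*` W.2)).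
  apply: bigcup_open => -[V W] /= [Vo Wo _].
  rewrite (_ : _ `*` _ = fst @^-1` V `&` snd @^-1` W) //.
  apply: openI; first by move/continuousP: (@continuous_fst Z X); apply.
  by move/continuousP: (@continuous_snd Z X); apply.
apply/seteqP; split=> [[y x] yxO|[y x] [[V W] [_ _ sub] /= []]]; last first.
  by move=> Vy Wx; apply: sub.
have [[P Q] /= []] := Oo _ yxO; rewrite !nbhsE.
move=> -[P' [/eO[V Vo ->] Vy] VP] [W [Wo Wx] WQ] PQO.
exists (V, W) => //; split=> // -[y' x'] /= [Vy' Wx']; apply: PQO; split=> /=.
  exact: VP.
exact: WQ.
Qed.

Section Main.
Variables kappa mu : ord.
Hypothesis kappa_card : is_cardinal kappa.
Hypothesis kappa_unc : ~ countable [set: kappa].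
Hypothesis mu_cof : is_cofinality kappa mu.
Hypothesis kappa_sing : (mu < kappa)%ord.
Hypothesis pow_kappa : [set: bseq_lt kappa] #= [set: kappa].
Variable X : topologicalType.
Hypothesis X_inh : [set: X] !=set0.
Hypothesis X_Fsigma : small_Fsigma kappa X.

Local Notation C := (cantor kappa).
Local Notation Sg := (Sigma0 kappa).

Let C_Fsigma : small_Fsigma kappa C.
Proof. exact: small_Fsigma_cantor mu_cof kappa_sing _ X_inh X_Fsigma. Qed.

Let C_weight := cantor_weight kappa_unc pow_kappa.

(** Two coordinates of a sequence give a copy of the universal set in [C]; fixing
    the first one reduces the corresponding section to it. *)
Lemma complete_of_universal a : section_universal kappa a C C ->
  has_complete kappa (bSigma kappa a) C.
Proof.
move=> [U US UP]; have [dec [decc _ enc]] := coding kappa_card kappa_unc.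
have [x0 _] : [set: kappa] !=set0.
  by apply: infinite_setN0 => /finite_set_countable.
have [x1 x01] := kappa_nomax kappa_card kappa_unc x0.
have x01' : x0 <> x1 by move=> E; rewrite E olt_irr in x01.
exists ((fun z => (dec x0 z, dec x1 z)) @^-1` U); split.
  by apply: Sigma0_preimage US; apply: continuous_pair; exact: decc.
move=> _ /UP[y ->]; have [f fc fP] := enc _ _ x01' y; exists f => //.
by apply/seteqP; split=> z /=; have [-> ->] := fP z.
Qed.

Lemma complete_extend a (e : C -> X) : continuous e ->
  (forall O : set C, open O -> exists2 O', open O' & O = e @^-1` O') ->
  has_complete kappa (bSigma kappa a) C -> has_complete kappa (bSigma kappa a) X.
Proof.
move=> ec eO [A [AS AP]]; have [A' A'S AE] := Sigma0_extend eO AS.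
exists A'; split=> // B /AP[f fc ->]; exists (e \o f); last by rewrite AE.
by move=> x; apply: continuous_comp; [exact: fc|exact: ec].
Qed.

Lemma universal_extend a (e : C -> X) :
  (forall O : set C, open O -> exists2 O', open O' & O = e @^-1` O') ->
  section_universal kappa a C X -> section_universal kappa a X X.
Proof.
move=> eO [U US UP].
have [U' U'S UE] := Sigma0_extend (prod_preimage_open eO) US.
exists U' => // A /UP[y ->]; exists (e y); by rewrite UE.
Qed.

Lemma odd_compl (a : ord) (T : topologicalType) (A : set T) :
  small_Fsigma kappa T -> odd_level a -> [set: a] #<= [set: kappa] ->
  Sg a (~` A) <-> Sg a A.
Proof.
move=> TF [b bE ab] ak.
have H (B : set T) : Sg a B -> Sg a (~` B).
  move/(Sigma0_iso ab) => BS; apply: (Sigma0_iso (ord_iso_sym ab)).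
  apply: (odd_level_compl kappa_card kappa_unc mu_cof kappa_sing pow_kappa TF _ _ BS).
    exact: level_ge1.
  apply: (even_level_open_like kappa_card kappa_unc mu_cof) => //.
  apply: card_le_trans ak; apply: ord_le_card; left.
  exact: ord_lt_le_trans (ord_lt_succ _) (ord_iso_ge ab).
by split=> [/H|/H//]; rewrite setCK.
Qed.

Lemma odd_no_universal (a : ord) (T : topologicalType) :
  small_Fsigma kappa T -> odd_level a -> [set: a] #<= [set: kappa] ->
  ~ has_universal (bSigma kappa a) T T /\ ~ has_universal (bPi kappa a) T T.
Proof.
move=> TF aO ak; split; apply: has_universal_diag => [f U|A].
- exact: Sigma0_preimage.
- by move=> AS; apply/odd_compl.
- exact: bPi_preimage.
- by move=> /bPiP AS; apply/bPiP; apply/odd_compl.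
Qed.

(** A complete set at level [a = b + 1] is a union, over some small [S], of
    complements of sets of level [b]. Taking preimages, so are all sets of level [a]
    in [C], with the same [S]; coding [S] many sets by means of the universal set for
    level [b] would therefore give a universal set for level [a]. *)
Lemma odd_no_complete (a : ord) (Z : topologicalType) :
  odd_level a -> [set: a] #<= [set: kappa] -> ~ has_complete kappa (bSigma kappa a) Z.
Proof.
move=> aO ak [A [AS AP]]; have [noU _] := odd_no_universal C_Fsigma aO ak.
have [b bE ab] := aO; have b1 := level_ge1 bE.
have ba : (b < a)%ord by exact: ord_lt_le_trans (ord_lt_succ _) (ord_iso_ge ab).
have bk : [set: b] #<= [set: kappa].
  by apply: card_le_trans ak; exact: ord_le_card (ord_ltW ba).
have [U US UP] := universal_even kappa_card kappa_unc mu_cof kappa_sing pow_kappa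
  C_weight C_Fsigma bE bk.
have [dec [decc decs _]] := coding kappa_card kappa_unc.
apply: noU; apply: section_universalP.
case/Sigma0_small_inv: AS => [[a1 _]|[S [c [B [a1 sS cP cB AE]]]]].
  case: (@ord_lt_irr (ofin 1)); apply: ord_le_lt_trans b1 (ord_lt_le_trans ba _).
  exact: ord_iso_le.
have /card_leTP[h hinj] := small_le_kappa sS.
exists (\bigcup_s ~` ((fun u => (dec (h s) u.1, u.2)) @^-1` U)).
  apply: (Sigma0_small_bigcup (b := fun=> b)) => // s.
  apply: Sigma0_preimage US; apply: continuous_pair; last exact: continuous_snd.
  by move=> u; apply: continuous_comp; [exact: continuous_fst|exact: decc].
move=> D /AP[f fc ->].
have /choice[Y YP] s : exists y, f @^-1` B s = [set x | U (y, x)].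
  apply: UP; apply: (Sigma0_le C_Fsigma (cP s).1).
    by apply/ord_lt_succP; apply: ord_lt_le_trans (cP s).2 (ord_iso_le ab).
  exact: Sigma0_preimage.
have [y yP] := decs _ h Y hinj; exists y; rewrite AE preimage_bigcup.
apply/seteqP; split=> x [s _ sx]; exists s => //=.
  rewrite yP => Ux; apply: sx; suff : (f @^-1` B s) x by [].
  by rewrite YP.
by move=> Bx; apply: sx => /=; rewrite yP; suff : [set x | U (Y s, x)] x by []; rewrite -YP.
Qed.

Lemma even_positive (a : ord) (Y : topologicalType) :
  section_universal kappa a Y X -> has_universal (bSigma kappa a) Y X /\
    has_universal (bPi kappa a) Y X.
Proof.
by move=> /section_universalP U; split=> //; exact: has_universalC.
Qed.

Lemma has_completeC a (Z : topologicalType) : has_complete kappa (bSigma kappa a) Z <->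
  has_complete kappa (bPi kappa a) Z.
Proof.
split=> -[A]; first by move=> /completeC; exists (~` A).
by rewrite -{1}[A]setCK => /completeC; exists (~` A).
Qed.

Lemma odd_negative (a : ord) (Z : topologicalType) : small_Fsigma kappa Z ->
  odd_level a -> [set: a] #<= [set: kappa] ->
  [/\ ~ has_universal (bSigma kappa a) Z Z /\ ~ has_complete kappa (bSigma kappa a) Z,
      ~ has_universal (bPi kappa a) Z Z /\ ~ has_complete kappa (bPi kappa a) Z &
      ~ has_universal (bDelta kappa a) Z Z /\ ~ has_complete kappa (bDelta kappa a) Z].
Proof.
move=> ZF aO ak; have [nS nP] := odd_no_universal ZF aO ak.
have nC := @odd_no_complete a Z aO ak.
split; split=> //; first by move/has_completeC.
  exact: bDelta_no_universal.
move=> [A [[AS _] AP]]; apply: nC; exists A; split=> // B BS; apply: AP.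
by split=> //; apply/bPiP/odd_compl.
Qed.

End Main.

(** The length of the union is less than [mu_plus], so [mu] can index it. *)
Lemma small_Fsigma_of_Sigma2 kappa mu mu_plus (X : topologicalType) :
  (mu < kappa)%ord -> is_succ_cardinal mu mu_plus ->
  bSigma kappa (ofin 1) X `<=` bSigma mu_plus (ofin 2) X -> small_Fsigma kappa X.
Proof.
move=> muk mup sub; exists mu; split; first exact: ord_small.
move=> O Oo; have : bSigma mu_plus (ofin 2) X O.
  by apply: sub; apply/Sigma0_1P; [exact: ord_iso_refl|].
case/Sigma0_inv => [[e21 _]|[d [b [B [_ dm bP bB ->]]]]].
  by case: (@ord_lt_irr (ofin 1)); apply: ord_lt_le_trans ofin1_lt2 (ord_iso_le e21).
have /card_leTP[h hinj] := succ_cardinal_card mup dm.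
have Bo i : open (B i).
  have [b1 b2] := bP i; have := bB i; rewrite (Sigma0_1P _ _ _) //.
  apply: ord_le_iso => //; apply/ord_lt_succP; apply: ord_lt_le_trans b2 _.
  exact: ord_iso_le (ofin_succ 1).
exists (fun n => \bigcup_(i in [set i | h i = n]) ~` B i) => [n|].
  have [[i ih]|ni] := pselect (exists i, h i = n).
    rewrite (_ : bigcup _ _ = ~` B i); first exact: open_closedC.
    apply/seteqP; split=> [x [j /= jn xj]|x xi]; last by exists i.
    by rewrite (hinj i j) // ih jn.
  rewrite (_ : bigcup _ _ = set0); first exact: closed0.
  by rewrite -subset0 => x [i /= ih _]; apply: ni; exists i.
apply/seteqP; split=> [x [i _ xi]|x [n _ [i _ xi]]]; last by exists i.
by exists (h i) => //; exists i.
Qed.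

Theorem proposition5p10 (kappa mu kappa_plus mu_plus : ord)
  (kappa_card : is_cardinal kappa)
  (kappa_unc : ~ countable [set: kappa])
  (mu_cof : is_cofinality kappa mu)
  (kappa_sing : (mu < kappa)%ord)
  (pow_kappa : [set: bseq_lt kappa] #= [set: kappa])
  (kappa_plusE : is_succ_cardinal kappa kappa_plus)
  (mu_plusE : is_succ_cardinal mu mu_plus)
  (X : topologicalType)
  (X_nonempty : [set: X] !=set0)
  (X_regular : regular_space X)
  (X_hausdorff : hausdorff_space X)
  (X_weight : weight_le X kappa)
  (X_open : bSigma kappa (ofin 1) X `<=` bSigma mu_plus (ofin 2) X)
  (alpha : ord) (alpha_lt : (alpha < kappa_plus)%ord) :
  let Sg := bSigma kappa (ofin 1 + alpha)%ord in
  let Pi := bPi kappa (ofin 1 + alpha)%ord in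
  let Dl := bDelta kappa (ofin 1 + alpha)%ord in
  let Bor := bBor kappa in
  let C := cantor kappa : topologicalType in
  [/\ even_ord alpha ->
        [/\ has_universal Sg C X /\ has_universal Pi C X,
            has_complete kappa Sg C /\ has_complete kappa Pi C &
            ~ has_universal Dl C C /\ ~ has_universal Bor C C],
      odd_ord alpha ->
        [/\ ~ has_universal Sg C C /\ ~ has_complete kappa Sg C,
            ~ has_universal Pi C C /\ ~ has_complete kappa Pi C &
            ~ has_universal Dl C C /\ ~ has_complete kappa Dl C] &
      embeds C X ->
        (even_ord alpha ->
          [/\ has_universal Sg X X /\ has_universal Pi X X,
              has_complete kappa Sg X /\ has_complete kappa Pi X &
              ~ has_universal Dl X X /\ ~ has_universal Bor X X]) /\
        (odd_ord alpha ->
          [/\ ~ has_universal Sg X X /\ ~ has_complete kappa Sg X,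
              ~ has_universal Pi X X /\ ~ has_complete kappa Pi X &
              ~ has_universal Dl X X /\ ~ has_complete kappa Dl X])].
Proof.
move=> Sg Pi Dl Bor C.
have X_Fsigma := small_Fsigma_of_Sigma2 kappa_sing mu_plusE X_open.
have C_Fsigma : small_Fsigma kappa C.
  exact: small_Fsigma_cantor mu_cof kappa_sing _ X_nonempty X_Fsigma.
have C_weight := cantor_weight kappa_unc pow_kappa.
have ak : [set: (ofin 1 + alpha)%ord] #<= [set: kappa].
  apply: (@card_le_trans _ _ _ [set: option kappa]); last first.
    by apply: card_le_option => /finite_set_countable.
  have /card_leTP[h hinj] := succ_cardinal_card kappa_plusE alpha_lt.
  apply/card_leTP; exists (fun u => if u is inr x then Some (h x) else None).
  by move=> [i|x] [j|y] //; [rewrite (ord1 i) (ord1 j)|move=> [/hinj ->]].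
have even_univ (Y : topologicalType) : weight_le Y kappa -> small_Fsigma kappa Y ->
    even_ord alpha -> section_universal kappa (ofin 1 + alpha)%ord C Y.
  move=> Yw YF /even_ord_level aE.
  exact: (universal_even kappa_card kappa_unc mu_cof kappa_sing).
have even_compl : even_ord alpha -> has_complete kappa Sg C.
  by move=> aE; apply: complete_of_universal => //; exact: even_univ.
split=> [aE|aO|/embeds_open[e [ec eO]]].
- split; first exact: even_positive (even_univ X X_weight X_Fsigma aE).
    by have := even_compl aE; split=> //; apply/has_completeC.
  by split; [exact: bDelta_no_universal|exact: bBor_no_universal].
- exact: (odd_negative kappa_card kappa_unc mu_cof kappa_sing _ X_nonempty X_Fsigma)
    (odd_ord_level aO) ak.
split=> [aE|aO].
  split.
  - apply: even_positive; apply: (universal_extend eO); exact: even_univ.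
  - have := complete_extend ec eO (even_compl aE).
    by split=> //; apply/has_completeC.
  - by split; [exact: bDelta_no_universal|exact: bBor_no_universal].
exact: (odd_negative kappa_card kappa_unc mu_cof kappa_sing _ X_nonempty X_Fsigma)
  (odd_ord_level aO) ak.
Qed.
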